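(* Let $f_1,f_2$ be P-homeomorphisms of the circle $S^1=\mathbb{R}/\mathbb{Z}$ with the same irrational rotation number $\rho=\rho_{f_1}=\rho_{f_2}$. Assume that (1) for $i=1,2$, $f_i$ is $C^{2+\alpha}$ for some $\alpha>0$ on each interval of continuity of $Df_i$; (2) the total jumps of $f_1$ and $f_2$ do not coincide: $\sigma_{f_1}=\prod_{b\in B(f_1)}\sigma_{f_1}(b)\neq \sigma_{f_2}=\prod_{b\in B(f_2)}\sigma_{f_2}(b)$. Then any homeomorphism $h:S^1\to S^1$ conjugating $f_1$ and $f_2$ (i.e. $h\circ f_1=f_2\circ h$) is a singular function: at every point $x$ where the lift of $h$ has a finite derivative (hence at Lebesgue-almost every $x$) one has $Dh(x)=0$.
   Context: A P-homeomorphism is an orientation preserving circle homeomorphism $f$ which is differentiable except at a finite set $B(f)\subset S^1$ of break points, at each of which the one-sided derivatives $Df_-(b)$, $Df_+(b)$ exist and differ, and for which there are constants $0<c_1<c_2<\infty$ with $c_1<Df_\pm(b)<c_2$ for $b\in B(f)$, $c_1<Df(x)<c_2$ for $x\notin B(f)$, and $\log Df$ of bounded variation on $S^1$. The jump ratio at a break point $b$ is $\sigma_f(b)=Df_-(b)/Df_+(b)$, and the total jump is $\sigma_f=\prod_{b\in B(f)}\sigma_f(b)$. The rotation number is $\rho_f=\lim_{n\to\infty}F^n(x)/n \pmod 1$ for a lift $F$ of $f$. Two P-homeomorphisms with the same irrational rotation number are topologically conjugate. *)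

(* Defs.v *)
From Stdlib Require Import Reals Lra List Sorted.
Import ListNotations.
Open Scope R_scope.

(* Circles S^1 = R/Z are handled through lifts R -> R. *)

Definition circle_lift (F : R -> R) : Prop :=
  continuity F /\
  (forall x y, x < y -> F x < F y) /\
  (forall x, F (x + 1) = F x + 1).

Definition circle_homeo_lift (H : R -> R) : Prop :=
  continuity H /\
  ((forall x y, x < y -> H x < H y) /\ (forall x, H (x + 1) = H x + 1)
   \/
   (forall x y, x < y -> H y < H x) /\ (forall x, H (x + 1) = H x - 1)).

(* x projects to one of the break points in B (B is a list of points of [0,1)). *)
Definition is_break (B : list R) (x : R) : Prop :=
  exists b k, In b B /\ x = b + IZR k.

Definition right_deriv (F : R -> R) (x l : R) : Prop :=
  forall eps, 0 < eps -> exists delta, 0 < delta /\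
    forall h, 0 < h < delta -> Rabs ((F (x + h) - F x) / h - l) < eps.

Definition left_deriv (F : R -> R) (x l : R) : Prop :=
  forall eps, 0 < eps -> exists delta, 0 < delta /\
    forall h, 0 < h < delta -> Rabs ((F (x - h) - F x) / (- h) - l) < eps.

Fixpoint var_sum (g : R -> R) (l : list R) : R :=
  match l with
  | x :: ((y :: _) as t) => Rabs (g y - g x) + var_sum g t
  | _ => 0
  end.

Definition bounded_variation_off (B : list R) (g : R -> R) : Prop :=
  exists V, forall l : list R,
    StronglySorted Rlt l ->
    (forall x, In x l -> 0 <= x <= 1 /\ ~ is_break B x) ->
    var_sum g l <= V.

Definition P_homeo (F : R -> R) (B : list R) (DF DL DR : R -> R) : Prop :=
  circle_lift F /\
  NoDup B /\ (forall b, In b B -> 0 <= b < 1) /\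
  (forall x, ~ is_break B x -> derivable_pt_lim F x (DF x)) /\
  (forall x, is_break B x ->
     left_deriv F x (DL x) /\ right_deriv F x (DR x) /\ DL x <> DR x) /\
  (exists c1 c2, 0 < c1 < c2 /\
     (forall x, ~ is_break B x -> c1 < DF x < c2) /\
     (forall x, is_break B x -> c1 < DL x < c2 /\ c1 < DR x < c2)) /\
  bounded_variation_off B (fun x => ln (DF x)).

Definition total_jump (B : list R) (DL DR : R -> R) : R :=
  fold_right (fun b acc => (DL b / DR b) * acc) 1 B.

(* r is the rotation number (as a real, before reduction mod 1) of lift F *)
Definition rotation_number (F : R -> R) (r : R) : Prop :=
  forall x, Un_cv (fun n => Nat.iter n F x / INR n) r.

Definition irrational (r : R) : Prop :=
  forall p q : Z, q <> 0%Z -> r <> IZR p / IZR q.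

Definition piecewise_C2alpha (F : R -> R) (B : list R) (DF : R -> R) : Prop :=
  exists alpha C (D2 : R -> R), 0 < alpha /\
    (forall x, ~ is_break B x -> derivable_pt_lim DF x (D2 x)) /\
    (forall x y, x < y -> (forall z, x < z < y -> ~ is_break B z) ->
       forall u v, x < u < y -> x < v < y ->
         Rabs (D2 u - D2 v) <= C * Rpower (Rabs (u - v)) alpha).

(* Main.v *)
Require Import Defs.
From Stdlib Require Import Reals ZArith List Lra Lia Classical ClassicalEpsilon.
Open Scope R_scope.

(* Let [Phi] be [ln DF] with its jumps at the breaks removed.  It is Lipschitz, and its increment over one period is the logarithm [L] of the total jump.  For consecutive convergents [p/q], [p'/q'] of the rotation number, with close return maps [A x = F^q' x - p' < x < B x = F^q x - p], the sums [S_n = Phi + Phi o F + ... + Phi o F^(n-1)] satisfy the identity [(S_q x - S_q (A x)) + (S_q' (B x) - S_q' x) = L], because [q p' - q' p = 1]; the same identity for the identity map and for counting functions of the breaks gives Denjoy's estimates.  Suppose that [H] has a derivative [l > 0] at [x].  At the scale [B x - A x] the conjugacy [H] is affine up to a small relative error, so [ln D(F1^n)] and [ln D(F2^n) o H] are close away from the breaks.  Between breaks they differ from [S_n] for [F1] and from [S_n o H] for [F2] by constants, and only boundedly many breaks occur, so the left-hand sides for [F1] at [x] and [F2] at [H x] become arbitrarily close, and [L1 = L2]. *)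

(** * Real induction and one-sided derivatives *)

(** The obstacle is that breaks of [F^q] may lie anywhere near [x], and their positions change with
    the scale, so [log D(F^q)] cannot be compared directly at two given points. [S_q] is continuous
    across breaks. Its increment over [[A x, x]] or [[x, B x]] is therefore cut at the breaks of
    both maps; within one piece the unknown constants cancel, and the pieces add up. The number of
    pieces and the Lipschitz constant of [S_q] relative to the length [B x - A x] are bounded
    independently of the convergent. So the admissible error per piece can be fixed first, and the
    scale, at which [H] must be affine to that accuracy, chosen last. Equality of rotation numbers
    enters because the same convergents then serve both maps, and [H] carries [A x] and [B x] to the
    corresponding points of [F2]. *)

Lemma Rabs_le_elim (x a : R) : Rabs x <= a -> - a <= x <= a.
Proof. unfold Rabs. destruct (Rcase_abs x); lra. Qed.

(** Continuous induction: the supremum of the points up to which [P] holds inherits [P] and cannot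
    be less than [b]. It serves both for increments under one-sided slope bounds and, in place of
    compactness, for gluing local Lipschitz bounds. *)
Lemma real_induction (P : R -> Prop) (a b : R) :
  a <= b -> P a ->
  (forall x, a <= x < b -> P x ->
     exists d, 0 < d /\ forall y, x < y < x + d -> y <= b -> P y) ->
  (forall x, a < x <= b -> (forall y, a <= y < x -> P y) -> P x) ->
  P b.
Proof.
  intros Hab Pa Hr Hl.
  set (E := fun x => a <= x <= b /\ forall y, a <= y <= x -> P y).
  assert (Ea : E a).
  { split; [lra|]. intros y Hy. replace y with a by lra. exact Pa. }
  destruct (completeness E) as [m [Hub Hlub]].
  { exists b. intros x [Hx _]. lra. }
  { exists a; exact Ea. }
  assert (Ham : a <= m) by (apply Hub; exact Ea).
  assert (Hmb : m <= b) by (apply Hlub; intros x [Hx _]; lra).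
  assert (Hbelow : forall y, a <= y < m -> P y).
  { intros y Hy. destruct (classic (exists x, E x /\ y < x)) as [[x [[Hx HP] Hyx]]|N].
    - apply HP; lra.
    - assert (m <= y); [|lra]. apply Hlub. intros x Ex.
      destruct (Rle_or_lt x y) as [?|?]; [assumption|]. exfalso; apply N; eauto. }
  assert (Pm : P m).
  { destruct (Req_dec m a) as [->|Hne]; [exact Pa|]. apply Hl; [lra|exact Hbelow]. }
  destruct (Req_dec m b) as [<-|Hne]; [exact Pm|].
  destruct (Hr m ltac:(lra) Pm) as [d [Hd HP]].
  set (t := Rmin b (m + d / 2)).
  assert (Ht : m < t <= b /\ t < m + d).
  { unfold t, Rmin; destruct (Rle_dec b (m + d / 2)); lra. }
  assert (E t).
  { split; [lra|]. intros y Hy. destruct (Rlt_le_dec y m) as [?|?]; [apply Hbelow; lra|].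
    destruct (Req_dec y m) as [->|?]; [exact Pm|]. apply HP; lra. }
  assert (t <= m) by (apply Hub; assumption). lra.
Qed.

(** Iterates have only one-sided derivatives at breaks, so the usual mean value theorem is out of
    reach. Slopes to the right carry the bound forward, and continuity carries it to limits from the
    left. *)
Lemma right_slope_le (g : R -> R) (a b m : R) :
  a <= b -> continuity g ->
  (forall x, a <= x < b ->
     exists d, 0 < d /\ forall h, 0 < h < d -> g (x + h) - g x <= m * h) ->
  g b - g a <= m * (b - a).
Proof.
  intros Hab Hc Hs.
  set (k := fun y => g y - m * y).
  assert (Hk : continuity k).
  { unfold k. apply continuity_minus; [exact Hc|].
    apply (continuity_scal id m). apply derivable_continuous, derivable_id. }
  enough (k b <= k a) by (unfold k in *; lra).
  apply (real_induction (fun y => k y <= k a) a b Hab); [lra| |].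
  - intros x Hx Hkx. destruct (Hs x Hx) as [d [Hd HS]]. exists d; split; [exact Hd|].
    intros y Hy _. specialize (HS (y - x) ltac:(lra)).
    replace (x + (y - x)) with y in HS by ring. unfold k in *. nra.
  - intros x Hx Hy. destruct (Rle_or_lt (k x) (k a)) as [?|Hgt]; [assumption|exfalso].
    destruct (Hk x (k x - k a) ltac:(lra)) as [d [Hd Hd']].
    set (y := Rmax a (x - d / 2)).
    assert (a <= y < x /\ x - d < y).
    { unfold y, Rmax; destruct (Rle_dec a (x - d / 2)); lra. }
    specialize (Hd' y). specialize (Hy y ltac:(lra)).
    assert (Hlt : Rabs (k y - k x) < k x - k a).
    { apply Hd'. split; [split; [exact I|lra]|]. simpl. unfold R_dist.
      rewrite Rabs_left; lra. }
    apply Rabs_def2 in Hlt. lra.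
Qed.

Lemma right_deriv_increment_le (g : R -> R) (a b m : R) :
  a <= b -> continuity g ->
  (forall x, a <= x < b -> exists l, right_deriv g x l /\ l <= m) ->
  g b - g a <= m * (b - a).
Proof.
  intros Hab Hc Hd.
  destruct (Req_dec a b) as [->|Hne]; [lra|].
  apply le_epsilon. intros e He.
  replace (m * (b - a) + e) with ((m + e / (b - a)) * (b - a)) by (field; lra).
  assert (He' : 0 < e / (b - a)) by (apply Rdiv_lt_0_compat; lra).
  apply right_slope_le; [exact Hab|exact Hc|]. intros x Hx.
  destruct (Hd x Hx) as [l [Hl Hlm]]. destruct (Hl _ He') as [d [Hd0 Hd1]].
  exists d; split; [exact Hd0|]. intros h Hh. specialize (Hd1 h Hh).
  apply Rabs_def2 in Hd1.
  assert (Hq : (g (x + h) - g x) / h <= m + e / (b - a)) by lra.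
  apply (Rmult_le_compat_r h) in Hq; [|lra].
  replace ((g (x + h) - g x) / h * h) with (g (x + h) - g x) in Hq by (field; lra). exact Hq.
Qed.

Lemma right_deriv_opp (g : R -> R) (x l : R) :
  right_deriv g x l -> right_deriv (fun y => - g y) x (- l).
Proof.
  intros H e He. destruct (H e He) as [d [Hd Hd']]. exists d; split; [exact Hd|].
  intros h Hh. specialize (Hd' h Hh). rewrite <- Rabs_Ropp.
  replace (- ((- g (x + h) - - g x) / h - - l)) with ((g (x + h) - g x) / h - l)
    by (field; lra). exact Hd'.
Qed.

Lemma right_deriv_increment_ge (g : R -> R) (a b m : R) :
  a <= b -> continuity g ->
  (forall x, a <= x < b -> exists l, right_deriv g x l /\ m <= l) ->
  m * (b - a) <= g b - g a.
Proof.
  intros Hab Hc Hd.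
  enough (- g b - - g a <= - m * (b - a)) by lra.
  apply (right_deriv_increment_le (fun y => - g y)); [exact Hab| |].
  - apply (continuity_opp g Hc).
  - intros x Hx. destruct (Hd x Hx) as [l [Hl Hm]]. exists (- l).
    split; [apply right_deriv_opp; exact Hl|lra].
Qed.

(** As [g] is increasing, [g (x + h)] stays strictly to the right of [g x]: the right derivative of
    [f] applies there and the two difference quotients multiply without division by zero. *)
Lemma right_deriv_comp (f g : R -> R) (x a b : R) :
  continuity g -> (forall y z, y < z -> g y < g z) ->
  right_deriv g x a -> right_deriv f (g x) b ->
  right_deriv (fun y => f (g y)) x (b * a).
Proof.
  intros Hc Hi Hg Hf.
  assert (lim : forall (u : R -> R) y l, right_deriv u y l ->
            limit1_in (fun h => (u (y + h) - u y) / h) (fun h => 0 < h) l 0).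
  { intros u y l Hu e He. destruct (Hu e He) as [d [Hd Hd']]. exists d; split; [exact Hd|].
    intros h [Hh Hhd]. simpl in *. unfold R_dist in *. rewrite Rminus_0_r, Rabs_right in Hhd by lra.
    apply Hd'; lra. }
  assert (L1 : limit1_in (fun h => g (x + h) - g x) (fun h => 0 < h) 0 0).
  { intros e He. destruct (Hc x e He) as [d [Hd Hd']]. exists d; split; [exact Hd|].
    intros h [Hh Hhd]. simpl in *. unfold R_dist in *.
    rewrite Rminus_0_r in *. apply Hd'. split; [split; [exact I|lra]|].
    replace (x + h - x) with h by ring. exact Hhd. }
  pose proof (limit_comp _ _ _ _ _ _ _ L1 (lim _ _ _ Hf)) as L2.
  pose proof (lim _ _ _ Hg) as L3.
  intros e He.
  assert (L2' : limit1_in (fun h => (f (g x + (g (x + h) - g x)) - f (g x)) / (g (x + h) - g x))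
                  (fun h => 0 < h) b 0).
  { intros e' He'. destruct (L2 e' He') as [d [Hd Hd']]. exists d; split; [exact Hd|].
    intros h [Hh Hhd]. apply Hd'. split; [|exact Hhd]. split; [exact Hh|].
    assert (g x < g (x + h)) by (apply Hi; lra). lra. }
  destruct (limit_mul _ _ _ _ _ _ L2' L3 e He) as [d [Hd Hd']].
  exists d; split; [exact Hd|]. intros h Hh.
  specialize (Hd' h). simpl in Hd'. unfold R_dist in Hd'.
  assert (g x < g (x + h)) by (apply Hi; lra).
  replace ((f (g (x + h)) - f (g x)) / h - b * a) with
    ((f (g x + (g (x + h) - g x)) - f (g x)) / (g (x + h) - g x) * ((g (x + h) - g x) / h) - b * a).
  - apply Hd'. split; [lra|]. rewrite Rminus_0_r, Rabs_right; lra.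
  - replace (g x + (g (x + h) - g x)) with (g (x + h)) by ring. field. lra.
Qed.

(** * Iterates and orbit sums *)

Lemma shift_IZR (g : R -> R) (c : R) :
  (forall x, g (x + 1) = g x + c) -> forall x k, g (x + IZR k) = g x + IZR k * c.
Proof.
  intros H.
  assert (Hn : forall n x, g (x + INR n) = g x + INR n * c).
  { induction n as [|n IH]; intros x; [simpl; replace (x + 0) with x by ring; ring|].
    rewrite S_INR. replace (x + (INR n + 1)) with (x + INR n + 1) by ring.
    rewrite H, IH. ring. }
  intros x k. destruct (Z_le_gt_dec 0 k) as [Hk|Hk].
  - rewrite <- (Z2Nat.id k Hk), <- INR_IZR_INZ. apply Hn.
  - replace k with (- Z.of_nat (Z.to_nat (- k)))%Z by lia.
    rewrite opp_IZR, <- INR_IZR_INZ. set (m := Z.to_nat (- k)).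
    generalize (Hn m (x + - INR m)).
    replace (x + - INR m + INR m) with x by ring. lra.
Qed.

Lemma iter_shift (F : R -> R) :
  (forall x, F (x + 1) = F x + 1) ->
  forall n x k, Nat.iter n F (x + IZR k) = Nat.iter n F x + IZR k.
Proof.
  intros H n x k. induction n as [|n IH]; simpl; [reflexivity|].
  rewrite IH, (shift_IZR F 1 H). ring.
Qed.

Lemma iter_lt (F : R -> R) :
  (forall x y, x < y -> F x < F y) ->
  forall n x y, x < y -> Nat.iter n F x < Nat.iter n F y.
Proof. intros H n. induction n as [|n IH]; simpl; auto. Qed.

Lemma iter_le (F : R -> R) :
  (forall x y, x < y -> F x < F y) ->
  forall n x y, x <= y -> Nat.iter n F x <= Nat.iter n F y.
Proof.
  intros H n x y [Hlt| ->]; [|lra]. left; apply iter_lt; assumption.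
Qed.

Lemma iter_continuity (F : R -> R) (n : nat) : continuity F -> continuity (Nat.iter n F).
Proof.
  intros H. induction n as [|n IH].
  - apply derivable_continuous, derivable_id.
  - apply (continuity_comp (Nat.iter n F) F IH H).
Qed.

Fixpoint orbit_sum (F g : R -> R) (n : nat) (x : R) : R :=
  match n with
  | O => 0
  | S m => orbit_sum F g m x + g (Nat.iter m F x)
  end.

Lemma orbit_sum_add (F g : R -> R) (n m : nat) (x : R) :
  orbit_sum F g (n + m) x = orbit_sum F g m x + orbit_sum F g n (Nat.iter m F x).
Proof.
  induction n as [|n IH]; simpl; [ring|]. rewrite IH, Nat.iter_add. ring.
Qed.

Lemma orbit_sum_shift (F g : R -> R) (c : R) :
  (forall x, F (x + 1) = F x + 1) -> (forall x, g (x + 1) = g x + c) ->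
  forall n x k, orbit_sum F g n (x + IZR k) = orbit_sum F g n x + INR n * IZR k * c.
Proof.
  intros HF Hg n x k. induction n as [|n IH]; [simpl; ring|].
  rewrite S_INR. simpl. rewrite IH, (iter_shift F HF), (shift_IZR g c Hg). ring.
Qed.

Lemma orbit_sum_le (F g : R -> R) :
  (forall x y, x < y -> F x < F y) -> (forall x y, x <= y -> g x <= g y) ->
  forall n x y, x <= y -> orbit_sum F g n x <= orbit_sum F g n y.
Proof.
  intros HF Hg n x y Hxy. induction n as [|n IH]; simpl; [lra|].
  apply Rplus_le_compat; [exact IH|]. apply Hg, iter_le; assumption.
Qed.

(** The hypothesis makes all increments of [u] along the orbit nonnegative, so a sum of length [m]
    may be bounded by one of the longer length [n]. *)
Lemma orbit_sum_increment_le (F g u : R -> R) (n m : nat) (x y : R) :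
  (m <= n)%nat ->
  (forall i, (i < n)%nat -> Rabs (g (Nat.iter i F y) - g (Nat.iter i F x))
                            <= u (Nat.iter i F y) - u (Nat.iter i F x)) ->
  Rabs (orbit_sum F g m y - orbit_sum F g m x)
    <= orbit_sum F u n y - orbit_sum F u n x.
Proof.
  intros Hmn H. induction Hmn as [|n Hmn IH].
  - induction m as [|m IH]; simpl; [rewrite Rminus_diag, Rabs_R0; lra|].
    replace (orbit_sum F g m y + g (Nat.iter m F y) - (orbit_sum F g m x + g (Nat.iter m F x)))
      with ((orbit_sum F g m y - orbit_sum F g m x) + (g (Nat.iter m F y) - g (Nat.iter m F x)))
      by ring.
    eapply Rle_trans; [apply Rabs_triang|].
    specialize (IH ltac:(intros; apply H; lia)). specialize (H m ltac:(lia)). lra.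
  - simpl. specialize (IH ltac:(intros; apply H; lia)). specialize (H n ltac:(lia)).
    pose proof (Rabs_pos (g (Nat.iter n F y) - g (Nat.iter n F x))). lra.
Qed.

Definition return_map (F : R -> R) (q : nat) (p : Z) (x : R) : R := Nat.iter q F x - IZR p.

(* For monotone [g] and [A x < x < B x] every summand is nonnegative, so this identity plays the role of the dynamical partition of the circle by iterates of [A x, x] and [x, B x]. *)
Lemma orbit_sum_chain (F g : R -> R) (c : R) (q q' : nat) (p p' : Z) :
  (forall x, F (x + 1) = F x + 1) -> (forall x, g (x + 1) = g x + c) ->
  INR q * IZR p' - INR q' * IZR p = 1 ->
  forall x,
    orbit_sum F g q x - orbit_sum F g q (return_map F q' p' x)
    + (orbit_sum F g q' (return_map F q p x) - orbit_sum F g q' x) = c.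
Proof.
  intros HF Hg Hdet x. unfold return_map, Rminus.
  rewrite <- !opp_IZR, !(orbit_sum_shift F g c HF Hg), !opp_IZR.
  (* The sum of length [q + q'] at [x] is split in two orders; the shifts by [p] and [p'] leave
     [(q p' - q' p) c]. *)
  pose proof (orbit_sum_add F g q q' x) as H1.
  pose proof (orbit_sum_add F g q' q x) as H2.
  rewrite Nat.add_comm, H1 in H2.
  replace c with ((INR q * IZR p' - INR q' * IZR p) * c) at 3 by (rewrite Hdet; ring).
  lra.
Qed.

(** * Breaks, distortion and Denjoy's inequality *)

Definition rfloor (r : R) : R := IZR (Int_part r).

Lemma floor_spec (r : R) : rfloor r <= r < rfloor r + 1.
Proof. unfold rfloor. destruct (base_Int_part r). lra. Qed.

Lemma floor_unique (r : R) (k : Z) : IZR k <= r < IZR k + 1 -> rfloor r = IZR k.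
Proof.
  intros H. pose proof (floor_spec r) as H'. unfold rfloor in *. f_equal.
  assert (k < Int_part r + 1)%Z by (apply lt_IZR; rewrite plus_IZR; lra).
  assert (Int_part r < k + 1)%Z by (apply lt_IZR; rewrite plus_IZR; lra). lia.
Qed.

Lemma floor_ge (r : R) (k : Z) : IZR k <= r -> IZR k <= rfloor r.
Proof.
  intros H. pose proof (floor_spec r) as H'. unfold rfloor in *. apply IZR_le.
  assert (k < Int_part r + 1)%Z by (apply lt_IZR; rewrite plus_IZR; lra). lia.
Qed.

Lemma floor_lt (r : R) (k : Z) : r < IZR k -> rfloor r <= IZR k - 1.
Proof.
  intros H. pose proof (floor_spec r) as H'. unfold rfloor in *. rewrite <- minus_IZR. apply IZR_le.
  assert (Int_part r < k)%Z by (apply lt_IZR; lra). lia.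
Qed.

Lemma floor_le (r s : R) : r <= s -> rfloor r <= rfloor s.
Proof. intros H. apply floor_ge. pose proof (floor_spec r). unfold rfloor in *. lra. Qed.

Lemma floor_shift (r : R) : rfloor (r + 1) = rfloor r + 1.
Proof.
  unfold rfloor at 2. rewrite <- plus_IZR. apply floor_unique. rewrite plus_IZR.
  pose proof (floor_spec r). unfold rfloor in *. lra.
Qed.

(** The floor is right-continuous, so at a break [step] already has its new value, in agreement with
    the right derivatives used for iterates. *)
Definition step (J : list (R * R)) (x : R) : R :=
  fold_right (fun b acc => snd b * rfloor (x - fst b) + acc) 0 J.

(* Floor plus ceiling: unlike either alone, it jumps on both sides of each break, so cutting an interval at a break lowers the count of both halves. *)
Definition break_count (J : list (R * R)) (x : R) : R :=
  fold_right (fun b acc => rfloor (x - fst b) - rfloor (fst b - x) + acc) 0 J.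

Definition total_size (J : list (R * R)) : R :=
  fold_right (fun b acc => Rabs (snd b) + acc) 0 J.

Lemma total_size_nonneg (J : list (R * R)) : 0 <= total_size J.
Proof.
  induction J as [|b J IH]; simpl; [lra|]. pose proof (Rabs_pos (snd b)). lra.
Qed.

Lemma break_count_shift (J : list (R * R)) (x : R) :
  break_count J (x + 1) = break_count J x + 2 * INR (length J).
Proof.
  induction J as [|b J IH]; [simpl; ring|].
  unfold break_count in *. cbn [fold_right length].
  rewrite IH, S_INR.
  replace (x + 1 - fst b) with (x - fst b + 1) by ring.
  replace (fst b - x) with (fst b - (x + 1) + 1) by ring.
  rewrite !floor_shift. ring.
Qed.

Lemma break_count_le (J : list (R * R)) (x y : R) :
  x <= y -> break_count J x <= break_count J y.
Proof.
  intros H. unfold break_count. induction J as [|b J IH]; simpl; [lra|].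
  pose proof (floor_le (x - fst b) (y - fst b) ltac:(lra)).
  pose proof (floor_le (fst b - y) (fst b - x) ltac:(lra)). lra.
Qed.

Lemma step_variation (J : list (R * R)) (x y : R) :
  x <= y ->
  Rabs (step J y - step J x) <= total_size J * (break_count J y - break_count J x).
Proof.
  intros H. induction J as [|b J IH]; [simpl; rewrite Rminus_diag, Rabs_R0; lra|].
  pose proof (floor_le (x - fst b) (y - fst b) ltac:(lra)) as H1.
  pose proof (floor_le (fst b - y) (fst b - x) ltac:(lra)) as H2.
  pose proof (break_count_le J x y H) as H3.
  pose proof (total_size_nonneg J) as H4. pose proof (Rabs_pos (snd b)) as H5.
  unfold step, break_count, total_size in *. simpl.
  match goal with |- Rabs ?u <= _ =>
    replace u with (snd b * (rfloor (y - fst b) - rfloor (x - fst b)) +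
      (fold_right (fun b acc => snd b * rfloor (y - fst b) + acc) 0 J -
       fold_right (fun b acc => snd b * rfloor (x - fst b) + acc) 0 J)) by ring end.
  eapply Rle_trans; [apply Rabs_triang|]. rewrite Rabs_mult, (Rabs_right (_ - _)) by lra.
  nra.
Qed.

(** The floor term jumps when [e] is reached from the left, the ceiling term when [e] is left to the
    right; the remaining terms are monotone. *)
Lemma break_count_split (J : list (R * R)) (b e x y : R) (k : Z) (s : R) :
  In (b, s) J -> e = b + IZR k -> x < e < y ->
  break_count J x + 1 <= break_count J e /\ break_count J e + 1 <= break_count J y.
Proof.
  intros Hin He Hxy. induction J as [|c J IH]; [destruct Hin|].
  pose proof (break_count_le J x e ltac:(lra)) as G1.
  pose proof (break_count_le J e y ltac:(lra)) as G2.
  pose proof (floor_le (x - fst c) (e - fst c) ltac:(lra)).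
  pose proof (floor_le (fst c - e) (fst c - x) ltac:(lra)).
  pose proof (floor_le (e - fst c) (y - fst c) ltac:(lra)).
  pose proof (floor_le (fst c - y) (fst c - e) ltac:(lra)).
  unfold break_count in *. simpl.
  destruct Hin as [->|Hin]; [|specialize (IH Hin); lra].
  simpl in *.
  assert (rfloor (e - b) = IZR k) by (apply floor_unique; lra).
  pose proof (floor_lt (x - b) k ltac:(lra)).
  pose proof (floor_lt (b - y) (- k) ltac:(rewrite opp_IZR; lra)) as Hy.
  assert (rfloor (b - e) = IZR (- k)) by (apply floor_unique; rewrite opp_IZR; lra).
  rewrite opp_IZR in *. lra.
Qed.

Lemma step_const (J : list (R * R)) (x y : R) :
  x <= y ->
  (forall b s k, In (b, s) J -> x < b + IZR k <= y -> False) ->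
  step J y = step J x.
Proof.
  intros Hxy. induction J as [|[b s] J IH]; intros H; [reflexivity|].
  unfold step in *. simpl. f_equal.
  - f_equal. pose proof (floor_spec (x - b)) as Hx. pose proof (floor_spec (y - b)) as Hy.
    apply floor_unique. fold (rfloor (x - b)). split; [lra|].
    destruct (Rlt_le_dec (y - b) (rfloor (x - b) + 1)) as [?|Hc]; [assumption|exfalso].
    apply (H b s (Int_part (x - b) + 1)%Z); [left; reflexivity|].
    rewrite plus_IZR. fold (rfloor (x - b)). lra.
  - apply IH. intros b' s' k Hin. apply (H b' s' k). right; exact Hin.
Qed.

(* [J] lists the breaks with the logarithms of their jump ratios, and [L] is the logarithm of the total jump. *)
Definition break_lift (F Phi : R -> R) (J : list (R * R)) (K L : R) : Prop :=
  circle_lift F /\ 0 <= K /\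
  (forall x, right_deriv F x (exp (Phi x - step J x))) /\
  (forall x y, Rabs (Phi x - Phi y) <= K * Rabs (x - y)) /\
  (forall x, Phi (x + 1) = Phi x + L) /\
  (forall x, step J (x + 1) = step J x + L).

Definition log_deriv (F Phi : R -> R) (J : list (R * R)) : nat -> R -> R :=
  orbit_sum F (fun y => Phi y - step J y).

Lemma right_deriv_iter (F Phi : R -> R) (J : list (R * R)) (K L : R) :
  break_lift F Phi J K L ->
  forall n x, right_deriv (Nat.iter n F) x (exp (log_deriv F Phi J n x)).
Proof.
  intros [[Hc [Hi Hs]] [_ [Hd _]]] n x. induction n as [|n IH].
  - unfold log_deriv. simpl. rewrite exp_0. intros e He. exists 1; split; [lra|].
    intros h Hh. change (Rabs ((x + h - x) / h - 1) < e).
    replace ((x + h - x) / h - 1) with 0 by (field; lra). rewrite Rabs_R0; exact He.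
  - unfold log_deriv in *. simpl. rewrite exp_plus, Rmult_comm.
    apply (right_deriv_comp F (Nat.iter n F)); [now apply iter_continuity| |exact IH|apply Hd].
    intros y z; now apply iter_lt.
Qed.

Lemma iter_increment_le (F Phi : R -> R) (J : list (R * R)) (K L : R) :
  break_lift F Phi J K L ->
  forall n a b m, a <= b -> (forall x, a <= x < b -> log_deriv F Phi J n x <= m) ->
  Nat.iter n F b - Nat.iter n F a <= exp m * (b - a).
Proof.
  intros HF n a b m Hab Hm.
  apply right_deriv_increment_le; [exact Hab|apply iter_continuity, HF|].
  intros x Hx. exists (exp (log_deriv F Phi J n x)).
  split; [apply (right_deriv_iter _ _ _ _ _ HF)|].
  destruct (Hm x Hx) as [H| ->]; [left; now apply exp_increasing|lra].
Qed.

Lemma iter_increment_ge (F Phi : R -> R) (J : list (R * R)) (K L : R) :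
  break_lift F Phi J K L ->
  forall n a b m, a <= b -> (forall x, a <= x < b -> m <= log_deriv F Phi J n x) ->
  exp m * (b - a) <= Nat.iter n F b - Nat.iter n F a.
Proof.
  intros HF n a b m Hab Hm.
  apply right_deriv_increment_ge; [exact Hab|apply iter_continuity, HF|].
  intros x Hx. exists (exp (log_deriv F Phi J n x)).
  split; [apply (right_deriv_iter _ _ _ _ _ HF)|].
  destruct (Hm x Hx) as [H| <-]; [left; now apply exp_increasing|lra].
Qed.

(** The combinatorics of two consecutive convergents. With [A], [B] the return maps for [q'], [q],
    the condition [A (B x) <= x] says that [[A x, B x]] is covered by the two intervals [[A x, x]]
    and [[A (B x), B x]]. *)
Definition close_returns (F : R -> R) (q : nat) (p : Z) (q' : nat) (p' : Z) : Prop :=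
  (q' <= q)%nat /\ INR q * IZR p' - INR q' * IZR p = 1 /\
  forall x, return_map F q' p' x < x /\ x < return_map F q p x /\
            return_map F q' p' (return_map F q p x) <= x.

(** The first [q] images of [[A x, B x]] cover the circle at most twice: the chain identity at [x]
    handles [[A x, x]], and the one at [B x] handles [[A (B x), B x]]. *)
Lemma orbit_sum_multiplicity (F g : R -> R) (c : R) (q q' : nat) (p p' : Z) :
  circle_lift F -> close_returns F q p q' p' ->
  (forall x y, x <= y -> g x <= g y) -> (forall x, g (x + 1) = g x + c) ->
  forall x y z, return_map F q' p' x <= y <= return_map F q p x ->
    return_map F q' p' x <= z <= return_map F q p x ->
    orbit_sum F g q z - orbit_sum F g q y <= 2 * c.
Proof.
  intros [_ [Hi Hs]] [Hqq [Hdet Hr]] Hg Hgc x y z Hy Hz.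
  pose proof (orbit_sum_le F g Hi Hg) as Hm.
  destruct (Hr x) as [R1 [R2 R3]]. destruct (Hr (return_map F q p x)) as [R4 [R5 _]].
  pose proof (orbit_sum_chain F g c q q' p p' Hs Hgc Hdet x) as C1.
  pose proof (orbit_sum_chain F g c q q' p p' Hs Hgc Hdet (return_map F q p x)) as C2.
  pose proof (Hm q' _ _ (Rlt_le _ _ R2)). pose proof (Hm q' _ _ (Rlt_le _ _ R5)).
  pose proof (Hm q _ _ R3). pose proof (Hm q z _ (proj2 Hz)). pose proof (Hm q _ y (proj1 Hy)).
  lra.
Qed.

(** The multiplicity 2 times the increment over one period of
    [K * y + total_size J * break_count J y], a monotone function whose increments dominate those of
    [Phi - step J]. *)
Definition distortion_bound (J : list (R * R)) (K : R) : R :=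
  2 * (K + total_size J * (2 * INR (length J))).

Lemma distortion_bound_nonneg (J : list (R * R)) (K : R) : 0 <= K -> 0 <= distortion_bound J K.
Proof.
  intros H. unfold distortion_bound.
  pose proof (total_size_nonneg J). pose proof (pos_INR (length J)).
  pose proof (Rmult_le_pos (total_size J) (2 * INR (length J))). lra.
Qed.

Lemma distortion (F Phi : R -> R) (J : list (R * R)) (K L : R) (q q' : nat) (p p' : Z) :
  break_lift F Phi J K L -> close_returns F q p q' p' ->
  forall x y z i, (i <= q)%nat ->
    return_map F q' p' x <= y <= return_map F q p x ->
    return_map F q' p' x <= z <= return_map F q p x ->
    Rabs (log_deriv F Phi J i z - log_deriv F Phi J i y) <= distortion_bound J K.
Proof.
  intros HF HR.
  destruct HF as [HC [HK [_ [HL [HP HS]]]]]. pose proof HC as [_ [Hi Hsh]].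
  pose proof (total_size_nonneg J) as Hsz.
  set (u := fun y => K * y + total_size J * break_count J y).
  assert (Hu : forall x y, x <= y -> u x <= u y).
  { intros x y Hxy. unfold u. pose proof (break_count_le J x y Hxy). nra. }
  assert (Hus : forall x, u (x + 1) = u x + (K + total_size J * (2 * INR (length J)))).
  { intros x. unfold u. rewrite break_count_shift. ring. }
  assert (Hle : forall x y z i, (i <= q)%nat -> y <= z ->
    return_map F q' p' x <= y <= return_map F q p x ->
    return_map F q' p' x <= z <= return_map F q p x ->
    Rabs (log_deriv F Phi J i z - log_deriv F Phi J i y) <= distortion_bound J K).
  { intros x y z i Hiq Hyz Hy Hz. unfold distortion_bound.
    eapply Rle_trans; [apply (orbit_sum_increment_le F _ u q i y z Hiq)|].
    - intros j _. set (a := Nat.iter j F z). set (b := Nat.iter j F y).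
      assert (Hba : b <= a) by (apply iter_le; assumption).
      pose proof (HL a b) as H1. rewrite (Rabs_right (a - b)) in H1 by lra.
      pose proof (step_variation J b a Hba) as H2. unfold u.
      replace (Phi a - step J a - (Phi b - step J b)) with
        ((Phi a - Phi b) + - (step J a - step J b)) by ring.
      eapply Rle_trans; [apply Rabs_triang|]. rewrite Rabs_Ropp. lra.
    - apply (orbit_sum_multiplicity F u _ q q' p p' HC HR Hu Hus x); assumption. }
  intros x y z i Hiq Hy Hz. destruct (Rle_or_lt y z) as [?|?].
  - now apply (Hle x).
  - rewrite Rabs_minus_sym. apply (Hle x); try assumption. lra.
Qed.

Lemma orbit_sum_periodic (F g : R -> R) :
  (forall x, F (x + 1) = F x + 1) -> (forall x, g (x + 1) = g x) ->
  forall n x k, orbit_sum F g n (x + IZR k) = orbit_sum F g n x.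
Proof.
  intros HF Hg n x k. rewrite (orbit_sum_shift F g 0 HF); [ring|]. intros y. rewrite Hg. ring.
Qed.

Lemma log_deriv_periodic (F Phi : R -> R) (J : list (R * R)) (K L : R) :
  break_lift F Phi J K L ->
  forall n x k, log_deriv F Phi J n (x + IZR k) = log_deriv F Phi J n x.
Proof.
  intros [[_ [_ Hs]] [_ [_ [_ [HP HS]]]]]. apply orbit_sum_periodic; [exact Hs|].
  intros x. rewrite HP, HS. ring.
Qed.

Lemma orbit_sum_scale_le (F u v : R -> R) (t : R) (n : nat) (x y x' y' : R) :
  (forall i, (i < n)%nat -> u (Nat.iter i F y') - u (Nat.iter i F x')
                            <= t * (v (Nat.iter i F y) - v (Nat.iter i F x))) ->
  orbit_sum F u n y' - orbit_sum F u n x' <= t * (orbit_sum F v n y - orbit_sum F v n x).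
Proof.
  intros H. induction n as [|n IH]; simpl; [lra|].
  specialize (IH ltac:(intros; apply H; lia)). specialize (H n ltac:(lia)). lra.
Qed.

Lemma return_map_commute (F : R -> R) (q : nat) (p : Z) (i : nat) (x : R) :
  (forall x, F (x + 1) = F x + 1) ->
  Nat.iter i F (return_map F q p x) = return_map F q p (Nat.iter i F x).
Proof.
  intros Hs. unfold return_map, Rminus. rewrite <- opp_IZR, (iter_shift F Hs), <- !Nat.iter_add.
  now rewrite Nat.add_comm.
Qed.

Lemma return_map_comm (F : R -> R) (q q' : nat) (p p' : Z) (x : R) :
  (forall x, F (x + 1) = F x + 1) ->
  return_map F q' p' (return_map F q p x) = return_map F q p (return_map F q' p' x).
Proof.
  intros Hs. unfold return_map at 1. rewrite return_map_commute by exact Hs.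
  unfold return_map.
  unfold Rminus. rewrite <- !opp_IZR, (iter_shift F Hs), !opp_IZR. ring.
Qed.

(* The chain identity for [id] at [x] and at [G x] shows that a return map [G] preserves the total length of the partition, so [log DG] takes both signs up to the distortion along one orbit. *)
Lemma denjoy_inequality (F Phi : R -> R) (J : list (R * R)) (K L : R) (q q' : nat) (p p' : Z) :
  break_lift F Phi J K L -> close_returns F q p q' p' ->
  forall r, r = q \/ r = q' ->
  forall x, Rabs (log_deriv F Phi J r x) <= 2 * distortion_bound J K.
Proof.
  intros HF HR r Hr x.
  set (V := distortion_bound J K).
  pose proof HF as [HC _]. pose proof HC as [_ [Hi Hs]].
  pose proof HR as [Hqq [Hdet Hord]].
  assert (Hm : exists m, forall y,
             return_map F q' p' y <= return_map F r m y <= return_map F q p y).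
  { destruct Hr as [->| ->]; [exists p|exists p']; intros y; destruct (Hord y) as [? [? _]]; lra. }
  destruct Hm as [m Hm].
  assert (Hrq : (r <= q)%nat) by (destruct Hr as [->| ->]; lia).
  (* By the cocycle relation the difference equals the change of [log_deriv ... k] from [x] to
     [F^r x], and [F^r x] lies in [[A x, B x]] up to an integer; so [distortion] applies with time
     [k]. *)
  assert (Horb : forall k, (k <= q)%nat ->
     Rabs (log_deriv F Phi J r (Nat.iter k F x) - log_deriv F Phi J r x) <= V).
  { intros k Hk.
    pose proof (orbit_sum_add F (fun y => Phi y - step J y) r k x) as E1.
    pose proof (orbit_sum_add F (fun y => Phi y - step J y) k r x) as E2.
    rewrite Nat.add_comm, E1 in E2. fold (log_deriv F Phi J) in E2.
    pose proof (distortion F Phi J K L q q' p p' HF HR x x (return_map F r m x) k Hk) as D.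
    assert (E3 : log_deriv F Phi J k (return_map F r m x)
                 = log_deriv F Phi J k (Nat.iter r F x)).
    { unfold return_map, Rminus. rewrite <- opp_IZR.
      apply (log_deriv_periodic _ _ _ _ _ HF). }
    rewrite E3 in D. destruct (Hord x) as [? [? _]].
    specialize (D ltac:(lra) (Hm x)).
    replace (log_deriv F Phi J r (Nat.iter k F x) - log_deriv F Phi J r x) with
      (log_deriv F Phi J k (Nat.iter r F x) - log_deriv F Phi J k x); [exact D|].
    unfold log_deriv in *. lra. }
  (* One [V] moves along the orbit, a second one moves inside the interval around the orbit point.
     Together they reach every interval of the partition. *)
  assert (Hnear : forall k y, (k <= q)%nat ->
     return_map F q' p' (Nat.iter k F x) <= y <= return_map F q p (Nat.iter k F x) ->
     log_deriv F Phi J r x - 2 * V <= log_deriv F Phi J r y <= log_deriv F Phi J r x + 2 * V).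
  { intros k y Hk Hy. specialize (Horb k Hk).
    destruct (Hord (Nat.iter k F x)) as [? [? _]].
    pose proof (distortion F Phi J K L q q' p p' HF HR (Nat.iter k F x) (Nat.iter k F x) y r Hrq
      ltac:(lra) Hy) as D.
    fold V in D. apply Rabs_le_elim in D. apply Rabs_le_elim in Horb. lra. }
  assert (Hg : forall y, return_map F r m y = Nat.iter r F y - IZR m) by reflexivity.
  pose proof (orbit_sum_chain F (fun y => y) 1 q q' p p' Hs ltac:(reflexivity) Hdet x) as C1.
  pose proof (orbit_sum_chain F (fun y => y) 1 q q' p p' Hs ltac:(reflexivity) Hdet
                (return_map F r m x)) as C2.
  rewrite !(return_map_comm F r _ m _ x Hs) in C2.
  set (a := return_map F q' p' x) in *. set (b := return_map F q p x) in *.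
  assert (Hab : forall k, Nat.iter k F a = return_map F q' p' (Nat.iter k F x)
                       /\ Nat.iter k F b = return_map F q p (Nat.iter k F x)).
  { intros k. split; apply return_map_commute; exact Hs. }
  apply Rabs_le. split.
  (* Otherwise the return map would contract every interval of the partition by the factor
     [exp e < 1], although the total length is 1 before and after. The other half is the same with
     expansion. *)
  - apply Rnot_lt_le. intros Hlt.
    set (e := log_deriv F Phi J r x + 2 * V). assert (He : e < 0) by (unfold e; lra).
    assert (U : forall k y z, (k <= q)%nat -> y <= z ->
      return_map F q' p' (Nat.iter k F x) <= y -> z <= return_map F q p (Nat.iter k F x) ->
      return_map F r m z - return_map F r m y <= exp e * (z - y)).
    { intros k y z Hk Hyz Hy Hz. rewrite !Hg.
      pose proof (iter_increment_le F Phi J K L HF r y z e Hyz) as I.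
      enough (Nat.iter r F z - Nat.iter r F y <= exp e * (z - y)) by lra.
      apply I. intros w Hw. apply (Hnear k w Hk). lra. }
    assert (S1 : orbit_sum F (fun y => y) q (return_map F r m x)
                 - orbit_sum F (fun y => y) q (return_map F r m a)
                 <= exp e * (orbit_sum F (fun y => y) q x - orbit_sum F (fun y => y) q a)).
    { apply orbit_sum_scale_le. intros i Hi'. rewrite !return_map_commute by exact Hs.
      destruct (Hab i) as [-> _]. destruct (Hord (Nat.iter i F x)) as [? [? _]].
      apply (U i); [lia|lra|lra|lra]. }
    assert (S2 : orbit_sum F (fun y => y) q' (return_map F r m b)
                 - orbit_sum F (fun y => y) q' (return_map F r m x)
                 <= exp e * (orbit_sum F (fun y => y) q' b - orbit_sum F (fun y => y) q' x)).
    { apply orbit_sum_scale_le. intros i Hi'. rewrite !return_map_commute by exact Hs.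
      destruct (Hab i) as [_ ->]. destruct (Hord (Nat.iter i F x)) as [? [? _]].
      apply (U i); [lia|lra|lra|lra]. }
    pose proof (exp_increasing e 0 He) as X. rewrite exp_0 in X. nra.
  - apply Rnot_lt_le. intros Hlt.
    set (e := log_deriv F Phi J r x - 2 * V). assert (He : 0 < e) by (unfold e; lra).
    assert (U : forall k y z, (k <= q)%nat -> y <= z ->
      return_map F q' p' (Nat.iter k F x) <= y -> z <= return_map F q p (Nat.iter k F x) ->
      z - y <= exp (- e) * (return_map F r m z - return_map F r m y)).
    { intros k y z Hk Hyz Hy Hz. rewrite !Hg.
      pose proof (iter_increment_ge F Phi J K L HF r y z e Hyz) as I.
      assert (I' : exp e * (z - y) <= Nat.iter r F z - Nat.iter r F y).
      { apply I. intros w Hw. apply (Hnear k w Hk). lra. }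
      pose proof (exp_pos (- e)) as Pe.
      apply (Rmult_le_compat_l (exp (- e))) in I'; [|lra].
      rewrite <- Rmult_assoc, <- exp_plus, Rplus_opp_l, exp_0 in I'. lra. }
    assert (S1 : orbit_sum F (fun y => y) q x - orbit_sum F (fun y => y) q a
                 <= exp (- e) * (orbit_sum F (fun y => y) q (return_map F r m x)
                 - orbit_sum F (fun y => y) q (return_map F r m a))).
    { apply orbit_sum_scale_le. intros i Hi'. rewrite !return_map_commute by exact Hs.
      destruct (Hab i) as [-> _]. destruct (Hord (Nat.iter i F x)) as [? [? _]].
      apply (U i); [lia|lra|lra|lra]. }
    assert (S2 : orbit_sum F (fun y => y) q' b - orbit_sum F (fun y => y) q' x
                 <= exp (- e) * (orbit_sum F (fun y => y) q' (return_map F r m b)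
                 - orbit_sum F (fun y => y) q' (return_map F r m x))).
    { apply orbit_sum_scale_le. intros i Hi'. rewrite !return_map_commute by exact Hs.
      destruct (Hab i) as [_ ->]. destruct (Hord (Nat.iter i F x)) as [? [? _]].
      apply (U i); [lia|lra|lra|lra]. }
    pose proof (exp_increasing (- e) 0 ltac:(lra)) as X. rewrite exp_0 in X. nra.
Qed.

(** * Rotation numbers and close returns *)

(** Iterating the displacement bound gives [F^(n q) x <= x + n p]; dividing by [n q] bounds the
    limit by [p / q]. In the proof [n] is taken so large that [x] itself is negligible against half
    of the supposed gap. *)
Lemma rotation_number_le (F : R -> R) (rho : R) (q : nat) (p : Z) (x : R) :
  circle_lift F -> rotation_number F rho -> (0 < q)%nat ->
  Nat.iter q F x <= x + IZR p -> rho * INR q <= IZR p.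
Proof.
  intros [_ [Hi Hs]] Hrot Hq Hx.
  assert (Hn : forall n, Nat.iter (n * q) F x <= x + INR n * IZR p).
  { induction n as [|n IH]; [simpl; lra|].
    rewrite Nat.mul_succ_l, Nat.add_comm, Nat.iter_add, S_INR.
    pose proof (iter_le F Hi q _ _ IH) as H.
    rewrite INR_IZR_INZ, <- mult_IZR, (iter_shift F Hs), mult_IZR, <- INR_IZR_INZ in H. lra. }
  apply Rnot_lt_le. intros Hlt.
  assert (Hq1 : 1 <= INR q) by (change 1 with (INR 1); apply le_INR; lia).
  set (e := (rho - IZR p / INR q) / 2).
  assert (He : 0 < e).
  { unfold e. enough (IZR p / INR q < rho) by lra.
    apply (Rmult_lt_reg_r (INR q)); [lra|]. field_simplify; lra. }
  destruct (Hrot x e He) as [N HN].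
  destruct (INR_unbounded (INR N + Rabs x / e)) as [n Hn1].
  pose proof (pos_INR N) as PN.
  assert (0 <= Rabs x / e) by (apply Rle_mult_inv_pos; [apply Rabs_pos|exact He]).
  assert (HNn : (N <= n)%nat) by (apply INR_le; lra).
  specialize (HN (n * q)%nat ltac:(nia)). specialize (Hn n).
  assert (Hn0 : 0 < INR n) by lra.
  unfold R_dist in HN. rewrite mult_INR in HN. apply Rabs_def2 in HN.
  assert (Hnq : 0 < INR n * INR q) by nra.
  assert (H1 : (rho - e) * (INR n * INR q) <= Nat.iter (n * q) F x).
  { replace (Nat.iter (n * q) F x) with
      (Nat.iter (n * q) F x / (INR n * INR q) * (INR n * INR q)) by (field; lra).
    apply Rmult_le_compat_r; lra. }
  assert (H2 : (rho - e) = e + IZR p / INR q) by (unfold e; field; lra).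
  rewrite H2 in H1.
  replace ((e + IZR p / INR q) * (INR n * INR q)) with (e * (INR n * INR q) + INR n * IZR p)
    in H1 by (field; lra).
  assert (H3 : Rabs x < e * INR n).
  { replace (Rabs x) with (e * (Rabs x / e)) by (field; lra). apply Rmult_lt_compat_l; lra. }
  pose proof (Rle_abs x).
  assert (e * INR n <= e * (INR n * INR q)) by (apply Rmult_le_compat_l; [lra|nra]). lra.
Qed.

(** Follows from the previous bound for the reflected lift [y |-> - F (- y)], whose rotation number
    is [- rho]. *)
Lemma rotation_number_ge (F : R -> R) (rho : R) (q : nat) (p : Z) (x : R) :
  circle_lift F -> rotation_number F rho -> (0 < q)%nat ->
  x + IZR p <= Nat.iter q F x -> IZR p <= rho * INR q.
Proof.
  intros [Hc [Hi Hs]] Hrot Hq Hx.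
  set (G := fun y => - F (- y)).
  assert (HG : forall n y, Nat.iter n G y = - Nat.iter n F (- y)).
  { intros n y. induction n as [|n IH]; simpl; [ring|].
    rewrite IH. unfold G. now rewrite Ropp_involutive. }
  enough (- rho * INR q <= IZR (- p)) by (rewrite opp_IZR in *; lra).
  apply (rotation_number_le G (- rho) q (- p) (- x)); [|..|exact Hq|].
  - split; [|split].
    + apply (continuity_opp (fun y => F (- y))), (continuity_comp (fun y => - y) F); [|exact Hc].
      apply derivable_continuous, (derivable_opp id), derivable_id.
    + intros y z Hyz. unfold G. specialize (Hi (- z) (- y) ltac:(lra)). lra.
    + intros y. unfold G. pose proof (Hs (- (y + 1))) as E.
      replace (- (y + 1) + 1) with (- y) in E by ring. lra.
  - intros y e He. destruct (Hrot (- y) e He) as [N HN]. exists N. intros n Hn.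
    specialize (HN n Hn). unfold R_dist in *. rewrite HG, <- Rabs_Ropp.
    unfold Rdiv in *. rewrite Ropp_mult_distr_l_reverse.
    match goal with |- Rabs ?u < _ => match type of HN with Rabs ?v < _ =>
      replace u with v by ring end end. exact HN.
  - rewrite HG, Ropp_involutive, opp_IZR. lra.
Qed.

(* [p / q < rho < p' / q'] are Farey neighbours: consecutive continued fraction convergents, the lower one with the larger denominator. *)
Definition convergent_pair (rho : R) (q : nat) (p : Z) (q' : nat) (p' : Z) : Prop :=
  (0 < q')%nat /\ (q' <= q)%nat /\ INR q * IZR p' - INR q' * IZR p = 1 /\
  0 < INR q * rho - IZR p < IZR p' - INR q' * rho.

(** A displacement in the wrong direction at a single point would contradict the sign of [q rho - p]
    or [q' rho - p']. For [A (B x) <= x] the relevant sign is that of their sum, negative because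
    the lower gap is the smaller one. *)
Lemma convergent_pair_close_returns (F : R -> R) (rho : R) (q q' : nat) (p p' : Z) :
  circle_lift F -> rotation_number F rho -> convergent_pair rho q p q' p' ->
  close_returns F q p q' p'.
Proof.
  intros HC Hrot [Hq' [Hqq [Hdet Hab]]]. pose proof HC as [_ [Hi Hs]].
  split; [exact Hqq|]. split; [exact Hdet|]. intros x. unfold return_map. split; [|split].
  - apply Rnot_le_lt. intros H.
    pose proof (rotation_number_ge F rho q' p' x HC Hrot Hq' ltac:(lra)). lra.
  - apply Rnot_le_lt. intros H.
    pose proof (rotation_number_le F rho q p x HC Hrot ltac:(lia) ltac:(lra)). lra.
  - apply Rnot_lt_le. intros H. unfold Rminus in H.
    rewrite <- !opp_IZR, (iter_shift F Hs), <- Nat.iter_add, !opp_IZR in H.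
    pose proof (rotation_number_ge F rho (q' + q) (p + p') x HC Hrot ltac:(lia)
      ltac:(rewrite plus_IZR; lra)) as H1.
    rewrite plus_INR, plus_IZR in H1. lra.
Qed.

Lemma irrational_relation (rho : R) (q : nat) (p : Z) :
  irrational rho -> (0 < q)%nat -> INR q * rho <> IZR p.
Proof.
  intros Hirr Hq E. apply (Hirr p (Z.of_nat q) ltac:(lia)).
  rewrite <- INR_IZR_INZ, <- E. field. apply not_0_INR. lia.
Qed.

Lemma euclid_step (a b : R) :
  0 < a -> 0 < b -> (forall n : nat, a - INR n * b <> 0) ->
  exists n : nat, 0 < a - INR n * b < b.
Proof.
  intros Ha Hb Hn.
  destruct (INR_unbounded (a / b)) as [N HN].
  assert (HN' : a - INR N * b < 0).
  { enough (a / b * b < INR N * b) by (replace (a / b * b) with a in * by (field; lra); lra).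
    apply Rmult_lt_compat_r; assumption. }
  clear HN. induction N as [|N IH]; [simpl in HN'; lra|].
  destruct (Rtotal_order (a - INR N * b) 0) as [H|[H|H]]; [now apply IH|now elim (Hn N)|].
  exists N. rewrite S_INR in HN'. lra.
Qed.

(** A Euclidean division of the lower gap by the upper gap. Adding a multiple of one fraction's row
    to the other keeps the determinant, and irrationality keeps the remainder nonzero. *)
Lemma lower_euclid_step (rho : R) (q q' : nat) (p p' : Z) :
  irrational rho -> (0 < q)%nat -> (0 < q')%nat ->
  INR q * IZR p' - INR q' * IZR p = 1 ->
  0 < INR q * rho - IZR p -> 0 < IZR p' - INR q' * rho ->
  exists n : nat,
    INR (q + n * q') * IZR p' - INR q' * IZR (p + Z.of_nat n * p') = 1 /\
    0 < INR (q + n * q') * rho - IZR (p + Z.of_nat n * p') < IZR p' - INR q' * rho /\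
    (IZR p' - INR q' * rho < INR q * rho - IZR p -> (1 <= n)%nat).
Proof.
  intros Hirr Hq Hq' Hdet Ha Hb.
  assert (E : forall n : nat, INR (q + n * q') * rho - IZR (p + Z.of_nat n * p')
     = INR q * rho - IZR p - INR n * (IZR p' - INR q' * rho)).
  { intros n. rewrite plus_INR, mult_INR, plus_IZR, mult_IZR, <- INR_IZR_INZ. ring. }
  destruct (euclid_step (INR q * rho - IZR p) (IZR p' - INR q' * rho) Ha Hb) as [n Hn].
  { intros n. rewrite <- E.
    pose proof (irrational_relation rho (q + n * q') (p + Z.of_nat n * p') Hirr ltac:(lia)). lra. }
  exists n. rewrite E. repeat split; try lra.
  - rewrite plus_INR, mult_INR, plus_IZR, mult_IZR, <- INR_IZR_INZ. lra.
  - intros Hlt. destruct n; [simpl in Hn; lra|lia].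
Qed.

Lemma upper_euclid_step (rho : R) (q q' : nat) (p p' : Z) :
  irrational rho -> (0 < q)%nat -> (0 < q')%nat ->
  INR q * IZR p' - INR q' * IZR p = 1 ->
  0 < INR q * rho - IZR p -> 0 < IZR p' - INR q' * rho ->
  exists n : nat,
    INR q * IZR (p' + Z.of_nat n * p) - INR (q' + n * q) * IZR p = 1 /\
    0 < IZR (p' + Z.of_nat n * p) - INR (q' + n * q) * rho < INR q * rho - IZR p /\
    (INR q * rho - IZR p < IZR p' - INR q' * rho -> (1 <= n)%nat).
Proof.
  intros Hirr Hq Hq' Hdet Ha Hb.
  assert (E : forall n : nat, IZR (p' + Z.of_nat n * p) - INR (q' + n * q) * rho
     = IZR p' - INR q' * rho - INR n * (INR q * rho - IZR p)).
  { intros n. rewrite plus_INR, mult_INR, plus_IZR, mult_IZR, <- INR_IZR_INZ. ring. }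
  destruct (euclid_step (IZR p' - INR q' * rho) (INR q * rho - IZR p) Hb Ha) as [n Hn].
  { intros n. rewrite <- E.
    pose proof (irrational_relation rho (q' + n * q) (p' + Z.of_nat n * p) Hirr ltac:(lia)). lra. }
  exists n. rewrite E. repeat split; try lra.
  - rewrite plus_INR, mult_INR, plus_IZR, mult_IZR, <- INR_IZR_INZ. lra.
  - intros Hlt. destruct n; [simpl in Hn; lra|lia].
Qed.

Lemma convergent_pair_exists (rho : R) :
  irrational rho -> exists q p q' p', convergent_pair rho q p q' p'.
Proof.
  intros Hirr. set (p := Int_part rho).
  pose proof (floor_spec rho) as Hf. unfold rfloor in Hf. fold p in Hf.
  clearbody p.
  pose proof (irrational_relation rho 1 p Hirr ltac:(lia)) as Hne. simpl INR in Hne.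
  assert (IZR p < rho) by (destruct (Req_dec rho (IZR p)); [exfalso; apply Hne|]; lra).
  (* Start from the neighbours [p / 1] and [(p + 1) / 1]; one lower step makes the lower gap the
     smaller one. *)
  destruct (lower_euclid_step rho 1 1 p (p + 1) Hirr ltac:(lia) ltac:(lia)
    ltac:(simpl INR; rewrite ?plus_IZR; lra) ltac:(simpl INR; rewrite ?plus_IZR; lra)
    ltac:(rewrite plus_IZR; simpl INR; lra)) as [n [H1 [H2 _]]].
  exists (1 + n * 1)%nat, (p + Z.of_nat n * (p + 1))%Z, 1%nat, (p + 1)%Z.
  split; [lia|]. split; [lia|]. split; [exact H1|exact H2].
Qed.

(** The upper step makes the upper gap the smaller one and the lower step reverses this again. Both
    multipliers are at least 1, so the new lower denominator exceeds [q] and again dominates the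
    upper one. *)
Lemma convergent_pair_next (rho : R) (q q' : nat) (p p' : Z) :
  irrational rho -> convergent_pair rho q p q' p' ->
  exists r s r' s', convergent_pair rho r s r' s' /\ (q < r)%nat.
Proof.
  intros Hirr [Hq' [Hqq [Hdet Hab]]].
  destruct (upper_euclid_step rho q q' p p' Hirr ltac:(lia) Hq' Hdet ltac:(lra) ltac:(lra))
    as [k [K1 [K2 K3]]]. specialize (K3 ltac:(lra)).
  destruct (lower_euclid_step rho q (q' + k * q) p (p' + Z.of_nat k * p) Hirr ltac:(lia)
    ltac:(lia) K1 ltac:(lra) ltac:(lra)) as [n [N1 [N2 N3]]]. specialize (N3 ltac:(lra)).
  exists (q + n * (q' + k * q))%nat, (p + Z.of_nat n * (p' + Z.of_nat k * p))%Z,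
    (q' + k * q)%nat, (p' + Z.of_nat k * p)%Z.
  split; [|nia]. split; [lia|]. split; [nia|]. split; [exact N1|exact N2].
Qed.

Lemma orbit_sum_id_mono (F : R -> R) (n m : nat) (y z : R) :
  (forall x y, x < y -> F x < F y) -> (n <= m)%nat -> y <= z ->
  orbit_sum F (fun x => x) n z - orbit_sum F (fun x => x) n y
  <= orbit_sum F (fun x => x) m z - orbit_sum F (fun x => x) m y.
Proof.
  intros Hi Hnm Hyz. induction Hnm as [|m Hnm IH]; [lra|]. simpl.
  pose proof (iter_le F Hi m y z Hyz). lra.
Qed.

(* By Denjoy's inequality each convergent denominator below [q] contributes an interval of length comparable to [z - y] to the sum; this rules out wandering intervals. *)
Lemma convergent_pair_fine (F Phi : R -> R) (J : list (R * R)) (K L rho : R) :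
  break_lift F Phi J K L -> rotation_number F rho -> irrational rho ->
  forall m : nat, exists q p q' p', convergent_pair rho q p q' p' /\
    forall y z, y <= z ->
      INR m * (exp (- (2 * distortion_bound J K)) * (z - y))
      <= orbit_sum F (fun x => x) q z - orbit_sum F (fun x => x) q y.
Proof.
  intros HF Hrot Hirr m. pose proof HF as [HC _]. pose proof HC as [_ [Hi _]].
  induction m as [|m [q [p [q' [p' [Hc IH]]]]]].
  - destruct (convergent_pair_exists rho Hirr) as [q [p [q' [p' Hc]]]].
    exists q, p, q', p'. split; [exact Hc|]. intros y z Hyz. simpl INR.
    pose proof (orbit_sum_le F (fun x => x) Hi ltac:(auto) q y z Hyz). lra.
  - destruct (convergent_pair_next rho q q' p p' Hirr Hc) as [r [s [r' [s' [Hc' Hqr]]]]].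
    exists r, s, r', s'. split; [exact Hc'|]. intros y z Hyz.
    specialize (IH y z Hyz).
    pose proof (orbit_sum_id_mono F (S q) r y z Hi Hqr Hyz) as M. simpl in M.
    pose proof (convergent_pair_close_returns F rho q q' p p' HC Hrot Hc) as HR.
    pose proof (iter_increment_ge F Phi J K L HF q y z (- (2 * distortion_bound J K)) Hyz) as D.
    rewrite S_INR.
    enough (exp (- (2 * distortion_bound J K)) * (z - y) <= Nat.iter q F z - Nat.iter q F y) by lra.
    apply D. intros x _.
    pose proof (denjoy_inequality F Phi J K L q q' p p' HF HR q (or_introl eq_refl) x) as DD.
    apply Rabs_le_elim in DD. lra.
Qed.

(** The lengths of the first [q] images of [[A x, B x]] add up to at most 2 by multiplicity, but to
    at least [m * c] times its own length; [m > 2 / (c * eps)] forces that length below [eps]. *)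
Lemma small_close_returns (F Phi : R -> R) (J : list (R * R)) (K L rho : R) :
  break_lift F Phi J K L -> rotation_number F rho -> irrational rho ->
  forall eps, 0 < eps -> exists q p q' p', convergent_pair rho q p q' p' /\
    forall x, return_map F q p x - return_map F q' p' x < eps.
Proof.
  intros HF Hrot Hirr eps He. pose proof HF as [HC _].
  set (c := exp (- (2 * distortion_bound J K))).
  assert (Hc0 : 0 < c) by apply exp_pos.
  destruct (INR_unbounded (2 / (c * eps))) as [m Hm].
  destruct (convergent_pair_fine F Phi J K L rho HF Hrot Hirr m) as [q [p [q' [p' [Hc Hs]]]]].
  exists q, p, q', p'. split; [exact Hc|]. intros x.
  pose proof (convergent_pair_close_returns F rho q q' p p' HC Hrot Hc) as HR.
  pose proof HR as [_ [_ Hord]]. destruct (Hord x) as [? [? _]].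
  specialize (Hs (return_map F q' p' x) (return_map F q p x) ltac:(lra)).
  pose proof (orbit_sum_multiplicity F (fun x => x) 1 q q' p p' HC HR ltac:(auto)
    ltac:(reflexivity) x (return_map F q' p' x) (return_map F q p x) ltac:(lra) ltac:(lra)) as M.
  fold c in Hs. set (d := return_map F q p x - return_map F q' p' x) in *.
  apply Rnot_le_lt. intros Hle.
  assert (Hce : 0 < c * eps) by nra.
  assert (2 < INR m * (c * eps)).
  { replace 2 with (2 / (c * eps) * (c * eps)) by (field; split; lra).
    apply Rmult_lt_compat_r; assumption. }
  assert (0 < INR m) by (eapply Rlt_trans; [|exact Hm]; apply Rdiv_lt_0_compat; lra).
  assert (INR m * (c * eps) <= INR m * (c * d)) by (apply Rmult_le_compat_l; nra).
  lra.
Qed.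

(** * Comparison of conjugate maps at a small scale *)

(** By bounded distortion each image of [[y, z]] takes up at most [exp (2 V)] times its original
    share of the image of [[A x, B x]]. The latter images have total length at most 2, and [Phi] is
    [K]-Lipschitz. *)
Lemma orbit_sum_lipschitz (F Phi : R -> R) (J : list (R * R)) (K L : R) (q q' : nat) (p p' : Z) :
  break_lift F Phi J K L -> close_returns F q p q' p' ->
  forall x y z r, (r <= q)%nat ->
    return_map F q' p' x <= y <= return_map F q p x ->
    return_map F q' p' x <= z <= return_map F q p x ->
    Rabs (orbit_sum F Phi r z - orbit_sum F Phi r y)
    <= 2 * K * exp (2 * distortion_bound J K) * Rabs (z - y)
       / (return_map F q p x - return_map F q' p' x).
Proof.
  intros HF HR.
  pose proof HF as [HC [HK [_ [HL _]]]]. pose proof HC as [_ [Hi Hsh]].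
  pose proof HR as [_ [_ Hord]].
  assert (Hle : forall x y z r, (r <= q)%nat -> y <= z ->
    return_map F q' p' x <= y <= return_map F q p x ->
    return_map F q' p' x <= z <= return_map F q p x ->
    Rabs (orbit_sum F Phi r z - orbit_sum F Phi r y)
    <= 2 * K * exp (2 * distortion_bound J K) * (z - y)
       / (return_map F q p x - return_map F q' p' x)).
  { intros x y z r Hr Hyz Hy Hz.
    destruct (Hord x) as [O1 [O2 _]].
    pose proof (distortion F Phi J K L q q' p p' HF HR x) as D.
    pose proof (orbit_sum_multiplicity F (fun y => y) 1 q q' p p' HC HR ltac:(auto)
      ltac:(reflexivity) x (return_map F q' p' x) (return_map F q p x) ltac:(lra) ltac:(lra)) as M.
    set (V := distortion_bound J K) in *.
    set (a := return_map F q' p' x) in *. set (b := return_map F q p x) in *.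
    set (t := exp (2 * V) * (z - y) / (b - a)).
    assert (Ht : 0 <= t).
    { unfold t. apply Rle_mult_inv_pos; [|lra]. pose proof (exp_pos (2 * V)). nra. }
    assert (S : orbit_sum F (fun y => y) q z - orbit_sum F (fun y => y) q y
                <= t * (orbit_sum F (fun y => y) q b - orbit_sum F (fun y => y) q a)).
    { apply orbit_sum_scale_le. intros i Hiq.
      set (w := log_deriv F Phi J i x).
      assert (Hw : forall v, a <= v <= b -> w - V <= log_deriv F Phi J i v <= w + V).
      { intros v Hv. specialize (D x v i ltac:(lia) ltac:(lra) Hv).
        apply Rabs_le_elim in D. unfold w. lra. }
      pose proof (iter_increment_le F Phi J K L HF i y z (w + V) Hyz) as U.
      pose proof (iter_increment_ge F Phi J K L HF i a b (w - V) ltac:(lra)) as U'.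
      assert (U1 : Nat.iter i F z - Nat.iter i F y <= exp (w + V) * (z - y))
        by (apply U; intros v Hv; apply Hw; lra).
      assert (U2 : exp (w - V) * (b - a) <= Nat.iter i F b - Nat.iter i F a)
        by (apply U'; intros v Hv; apply Hw; lra).
      apply (Rmult_le_compat_l t) in U2; [|exact Ht].
      replace (t * (exp (w - V) * (b - a))) with (exp (w + V) * (z - y)) in U2; [lra|].
      unfold t. replace (w + V) with (2 * V + (w - V)) by ring. rewrite exp_plus. field. lra. }
    pose proof (orbit_sum_increment_le F Phi (fun y => K * y) q r y z Hr) as I.
    assert (I' : forall n v, orbit_sum F (fun y => K * y) n v = K * orbit_sum F (fun y => y) n v).
    { intros n v. induction n as [|n IH]; simpl; [ring|]. rewrite IH. ring. }
    rewrite !I' in I. eapply Rle_trans; [apply I|].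
    - intros i _. pose proof (iter_le F Hi i y z Hyz) as Hyz'.
      pose proof (HL (Nat.iter i F z) (Nat.iter i F y)) as HL'.
      rewrite (Rabs_right (Nat.iter i F z - Nat.iter i F y)) in HL' by lra. lra.
    - rewrite <- Rmult_minus_distr_l.
      replace (2 * K * exp (2 * V) * (z - y) / (b - a)) with (K * (t * 2))
        by (unfold t; field; lra).
      apply Rmult_le_compat_l; [exact HK|]. nra. }
  intros x y z r Hr Hy Hz. destruct (Rle_or_lt y z) as [?|?].
  - rewrite (Rabs_right (z - y)) by lra. now apply Hle.
  - rewrite (Rabs_left (z - y)) by lra. rewrite Rabs_minus_sym, Ropp_minus_distr.
    apply Hle; try assumption. lra.
Qed.

Definition hits_break (F : R -> R) (J : list (R * R)) (r : nat) (e : R) : Prop :=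
  exists i b s k, (i < r)%nat /\ In (b, s) J /\ Nat.iter i F e = b + IZR k.

Lemma orbit_break_count_split (F : R -> R) (J : list (R * R)) (r : nat) (c e d : R) :
  (forall x y, x < y -> F x < F y) ->
  hits_break F J r e -> c < e < d ->
  orbit_sum F (break_count J) r c + 1 <= orbit_sum F (break_count J) r e /\
  orbit_sum F (break_count J) r e + 1 <= orbit_sum F (break_count J) r d.
Proof.
  intros Hi [i [b [s [k [Hir [Hin He]]]]]] Hced.
  induction Hir as [|r Hir IH].
  - simpl.
    pose proof (orbit_sum_le F (break_count J) Hi (break_count_le J) i c e ltac:(lra)).
    pose proof (orbit_sum_le F (break_count J) Hi (break_count_le J) i e d ltac:(lra)).
    pose proof (iter_lt F Hi i c e ltac:(lra)). pose proof (iter_lt F Hi i e d ltac:(lra)).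
    destruct (break_count_split J b (Nat.iter i F e) (Nat.iter i F c) (Nat.iter i F d) k s
      Hin He ltac:(lra)). lra.
  - simpl.
    pose proof (break_count_le J _ _ (iter_le F Hi r c e ltac:(lra))).
    pose proof (break_count_le J _ _ (iter_le F Hi r e d ltac:(lra))). lra.
Qed.

Lemma increasing_preimage (G : R -> R) (c d w : R) :
  continuity G -> c <= d -> G c <= w <= G d -> exists e, c <= e <= d /\ G e = w.
Proof.
  intros Hc Hcd [[H1|H1] [H2|H2]]; [|exists d; lra|exists c; lra|exists c; lra].
  destruct Hcd as [Hcd| ->]; [|lra].
  destruct (IVT (fun y => G y - w) c d) as [e [He E]]; try lra.
  - apply continuity_minus; [exact Hc|]. apply continuity_const. intros ? ?. reflexivity.
  - exists e. split; [exact He|lra].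
Qed.

(** A break met by an image of [(c, y]] pulls back to a point of [(c, y]]. The left end may itself
    be a break, since [step] is right-continuous. *)
Lemma orbit_step_const (F : R -> R) (J : list (R * R)) (r : nat) (c y : R) :
  continuity F -> (forall x y, x < y -> F x < F y) -> c <= y ->
  (forall e, c < e <= y -> ~ hits_break F J r e) ->
  orbit_sum F (step J) r y = orbit_sum F (step J) r c.
Proof.
  intros Hc Hi Hcy. induction r as [|r IH]; intros H; [reflexivity|]. simpl. f_equal.
  - apply IH. intros e He [i [b [s [k [? ?]]]]]. apply (H e He). exists i, b, s, k. split; [lia|tauto].
  - apply step_const; [now apply iter_le|]. intros b s k Hin Hk.
    destruct (increasing_preimage (Nat.iter r F) c y (b + IZR k)) as [e [He E]];
      [now apply iter_continuity|exact Hcy|lra|].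
    destruct (Req_dec e c) as [->|Hne]; [lra|].
    apply (H e ltac:(lra)). exists r, b, s, k. split; [lia|tauto].
Qed.

Lemma log_deriv_split (F Phi : R -> R) (J : list (R * R)) (r : nat) (y : R) :
  log_deriv F Phi J r y = orbit_sum F Phi r y - orbit_sum F (step J) r y.
Proof. unfold log_deriv. induction r as [|r IH]; simpl; [ring|]. rewrite IH. ring. Qed.

(** Here [v / t] and [v' / u] are the slopes of [F1^r] and [F2^r] over an interval and its image
    under [H]. As [H] multiplies both [t] and [v] nearly by [l], the slopes nearly agree. The term
    [3 * eta] comes from [1 + eta <= exp eta] and, for [eta <= 1/2],
    [exp (- (2 * eta)) <= 1 - eta]. *)
Lemma slope_comparison (t l u v v' w w' k k' eta : R) :
  0 < t -> 0 < l -> 0 <= eta <= 1 / 2 ->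
  exp (w - k) * t <= v <= exp (w + k) * t ->
  exp (w' - k') * u <= v' <= exp (w' + k') * u ->
  Rabs (u - l * t) <= eta * (l * t) ->
  Rabs (v' - l * v) <= eta * (l * v) ->
  Rabs (w - w') <= k + k' + 3 * eta.
Proof.
  intros Ht Hl He Hv Hv' Hu Huv. apply Rabs_le_elim in Hu. apply Rabs_le_elim in Huv.
  pose proof (exp_ineq1_le eta) as E1.
  assert (E2 : exp (- (2 * eta)) <= 1 - eta).
  { rewrite exp_Ropp. pose proof (exp_ineq1_le (2 * eta)).
    apply Rle_trans with (/ (1 + 2 * eta)); [apply Rinv_le_contravar; lra|].
    apply (Rmult_le_reg_l (1 + 2 * eta)); [lra|]. rewrite Rinv_r by lra. nra. }
  assert (Hlt : 0 < l * t) by nra.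
  assert (P : forall a, 0 < exp a) by (intros; apply exp_pos).
  assert (Hv0 : 0 < v) by (pose proof (P (w - k)); nra).
  assert (L : forall a b, exp a <= exp b -> a <= b).
  { intros a b Hab. apply Rnot_lt_le. intros Hba. apply exp_increasing in Hba. lra. }
  apply Rabs_le. split.
  - enough (w' - k' + - (2 * eta) <= w + k + eta) by lra.
    apply L. rewrite (exp_plus (w' - k')), (exp_plus (w + k)).
    apply (Rmult_le_reg_r (l * t)); [exact Hlt|].
    apply Rle_trans with (exp (w' - k') * u).
    + rewrite Rmult_assoc. apply Rmult_le_compat_l; [left; apply P|]. nra.
    + apply Rle_trans with v'; [lra|].
      apply Rle_trans with ((1 + eta) * (l * v)); [lra|].
      apply Rle_trans with (exp eta * (l * (exp (w + k) * t))); [|right; ring].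
      apply Rmult_le_compat; [lra|nra|lra|]. apply Rmult_le_compat_l; lra.
  - enough (w - k + - (2 * eta) <= w' + k' + eta) by lra.
    apply L. rewrite (exp_plus (w - k)), (exp_plus (w' + k')).
    apply (Rmult_le_reg_r (l * t)); [exact Hlt|].
    apply Rle_trans with v'.
    + apply Rle_trans with ((1 - eta) * (l * v)); [|lra].
      apply Rle_trans with (exp (- (2 * eta)) * (l * (exp (w - k) * t))); [right; ring|].
      pose proof (P (w - k)). pose proof (P (- (2 * eta))).
      apply Rmult_le_compat; [lra| |exact E2|apply Rmult_le_compat_l; lra].
      repeat apply Rmult_le_pos; lra.
    + apply Rle_trans with (exp (w' + k') * u); [lra|].
      rewrite Rmult_assoc.
      apply Rmult_le_compat_l; [left; apply P|]. nra.
Qed.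

Definition near_affine (H : R -> R) (l e : R) (y z : R) : Prop :=
  Rabs (H y - H z - l * (y - z)) <= e.

(* Away from breaks, [orbit_sum F Phi r] is [log D(F^r)] up to a constant, which is read off from increments of [F^r] over a short interval next to [e]; the nearly affine conjugacy [H] transports these increments. *)
Lemma break_free_end_comparison (F1 F2 H Phi1 Phi2 : R -> R) (J1 J2 : list (R * R))
    (K1 K2 L1 L2 : R) (r : nat) (c d a e l s delta Lam V eta : R) :
  break_lift F1 Phi1 J1 K1 L1 -> break_lift F2 Phi2 J2 K2 L2 ->
  continuity H -> (forall y z, y < z -> H y < H z) ->
  (forall y, H (Nat.iter r F1 y) = Nat.iter r F2 (H y)) ->
  0 < l -> 0 < s -> 0 < delta -> 0 <= Lam -> 0 <= V -> 0 <= eta <= 1 / 2 ->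
  c <= a -> a + s * delta <= d -> a <= e <= a + s * delta ->
  (forall y z, c <= y <= d -> c <= z <= d ->
     Rabs (orbit_sum F1 Phi1 r z - orbit_sum F1 Phi1 r y) <= Lam * Rabs (z - y) / delta) ->
  (forall y z, c <= y <= d -> c <= z <= d ->
     Rabs (orbit_sum F2 Phi2 r (H z) - orbit_sum F2 Phi2 r (H y))
     <= Lam * Rabs (H z - H y) / delta) ->
  (forall y, c < y < d -> ~ hits_break F1 J1 r y /\ ~ hits_break F2 J2 r (H y)) ->
  (forall y, - V <= log_deriv F1 Phi1 J1 r y) ->
  (forall y z, c <= y <= d -> c <= z <= d ->
     near_affine H l (eta * l * s * exp (- V) * delta) z y /\
     near_affine H l (eta * l * s * exp (- V) * delta) (Nat.iter r F1 z) (Nat.iter r F1 y)) ->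
  Rabs ((orbit_sum F1 Phi1 r e - orbit_sum F1 (step J1) r c)
        - (orbit_sum F2 Phi2 r (H e) - orbit_sum F2 (step J2) r (H c)))
  <= Lam * s + Lam * (2 * l * s) + 3 * eta.
Proof.
  intros HF1 HF2 Hc Hi Hconj Hl Hs Hd HLam HV Heta Hca Had Hae Lip1 Lip2 Hfree Hlow Haff.
  set (t := s * delta) in *. assert (Ht : 0 < t) by (unfold t; nra).
  pose proof HF1 as [[Hc1 [Hi1 _]] _]. pose proof HF2 as [[Hc2 [Hi2 _]] _].
  assert (Hle : forall y z, y <= z -> H y <= H z).
  { intros y z [?| ->]; [left; auto|lra]. }
  assert (EV : exp (- V) <= 1).
  { rewrite <- exp_0. destruct HV as [?|<-]; [left; apply exp_increasing; lra|].
    rewrite Ropp_0; lra. }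
  pose proof (exp_pos (- V)) as PV.
  destruct (Haff a (a + t) ltac:(lra) ltac:(lra)) as [A1 A2].
  unfold near_affine in A1, A2.
  replace (a + t - a) with t in A1 by ring.
  (* The factor [exp (- V)] makes the tolerance small relative to the image as well: [F1^r] may
     shrink [[a, a + t]], but not below length [exp (- V) * t]. *)
  assert (Eerr : eta * l * s * exp (- V) * delta = eta * (l * (exp (- V) * t))) by (unfold t; ring).
  rewrite Eerr in A1, A2. clear Eerr.
  set (u := H (a + t) - H a) in *.
  assert (Hu : Rabs (u - l * t) <= eta * (l * t)).
  { eapply Rle_trans; [exact A1|]. apply Rmult_le_compat_l; [lra|].
    apply Rmult_le_compat_l; [lra|]. nra. }
  assert (Hu2 : u <= 2 * l * t).
  { apply Rabs_le_elim in Hu. assert (eta * (l * t) <= 1 / 2 * (l * t)) by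
      (apply Rmult_le_compat_r; nra). nra. }
  set (v := Nat.iter r F1 (a + t) - Nat.iter r F1 a) in *.
  assert (Hv0 : exp (- V) * t <= v).
  { replace t with (a + t - a) at 1 by ring.
    apply (iter_increment_ge F1 Phi1 J1 K1 L1 HF1); [lra|]. intros; apply Hlow. }
  assert (Htd : forall y, 0 <= y -> Lam * (y * t) / delta = Lam * s * y).
  { intros y _. unfold t. field. lra. }
  apply (slope_comparison t l u v (Nat.iter r F2 (H (a + t)) - Nat.iter r F2 (H a))
    _ _ (Lam * s) (Lam * (2 * l * s)) eta); try assumption.
  (* Over length [t = s * delta] the sum of [Phi] moves by at most [Lam * s], while the sum of
     [step J1] keeps its value at [c]. *)
  - assert (Hw : forall y, a <= y < a + t ->
      orbit_sum F1 Phi1 r e - orbit_sum F1 (step J1) r c - Lam * s <= log_deriv F1 Phi1 J1 r y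
      <= orbit_sum F1 Phi1 r e - orbit_sum F1 (step J1) r c + Lam * s).
    { intros y Hy. rewrite log_deriv_split.
      rewrite (orbit_step_const F1 J1 r c y Hc1 Hi1 ltac:(lra)).
      2:{ intros e' He'. apply (Hfree e'). lra. }
      pose proof (Lip1 e y ltac:(lra) ltac:(lra)) as B.
      assert (B' : Lam * Rabs (y - e) / delta <= Lam * s).
      { rewrite <- (Rmult_1_r (Lam * s)), <- (Htd 1) by lra. unfold Rdiv.
        apply Rmult_le_compat_r; [left; now apply Rinv_0_lt_compat|].
        apply Rmult_le_compat_l; [exact HLam|]. apply Rabs_le; lra. }
      apply (fun h => Rle_trans _ _ _ h B') in B. apply Rabs_le_elim in B. lra. }
    set (w := orbit_sum F1 Phi1 r e - orbit_sum F1 (step J1) r c) in *.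
    pose proof (iter_increment_ge F1 Phi1 J1 K1 L1 HF1 r a (a + t) (w - Lam * s) ltac:(lra)) as I1.
    pose proof (iter_increment_le F1 Phi1 J1 K1 L1 HF1 r a (a + t) (w + Lam * s) ltac:(lra)) as I2.
    replace (a + t - a) with t in I1, I2 by ring.
    split; [apply I1|apply I2]; intros y Hy; apply Hw; lra.
  - assert (Hw : forall y', H a <= y' < H (a + t) ->
      orbit_sum F2 Phi2 r (H e) - orbit_sum F2 (step J2) r (H c) - Lam * (2 * l * s)
      <= log_deriv F2 Phi2 J2 r y'
      <= orbit_sum F2 Phi2 r (H e) - orbit_sum F2 (step J2) r (H c) + Lam * (2 * l * s)).
    { intros y' Hy'.
      destruct (increasing_preimage H a (a + t) y' Hc ltac:(lra) ltac:(lra)) as [y [Hy <-]].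
      rewrite log_deriv_split.
      rewrite (orbit_step_const F2 J2 r (H c) (H y) Hc2 Hi2 ltac:(apply Hle; lra)).
      2:{ intros e' He'.
          destruct (increasing_preimage H c y e' Hc ltac:(lra) ltac:(lra)) as [e1 [He1 <-]].
          apply (Hfree e1). split.
          - destruct (Req_dec e1 c) as [->|?]; lra.
          (* The point [a + t] may be [d], where a break is allowed; it is excluded because
             [H y < H (a + t)]. *)
          - destruct (Req_dec e1 (a + t)) as [->|?]; [|lra].
            assert (y = a + t) by lra. subst y. lra. }
      pose proof (Lip2 e y ltac:(lra) ltac:(lra)) as B.
      assert (B' : Lam * Rabs (H y - H e) / delta <= Lam * (2 * l * s)).
      { replace (Lam * (2 * l * s)) with (Lam * ((2 * l) * t) / delta) by (unfold t; field; lra).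
        unfold Rdiv.
        apply Rmult_le_compat_r; [left; now apply Rinv_0_lt_compat|].
        apply Rmult_le_compat_l; [exact HLam|].
        pose proof (Hle a e ltac:(lra)). pose proof (Hle e (a + t) ltac:(lra)).
        apply Rabs_le. unfold u in Hu2. lra. }
      apply (fun h => Rle_trans _ _ _ h B') in B. apply Rabs_le_elim in B. lra. }
    pose proof (Hle a (a + t) ltac:(lra)).
    split.
    + apply (iter_increment_ge F2 Phi2 J2 K2 L2 HF2); [lra|]. intros y Hy. apply Hw; lra.
    + apply (iter_increment_le F2 Phi2 J2 K2 L2 HF2); [lra|]. intros y Hy. apply Hw; lra.
  - rewrite <- !Hconj. eapply Rle_trans; [exact A2|].
    apply Rmult_le_compat_l; [lra|]. apply Rmult_le_compat_l; lra.
Qed.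

(** Cutting at a bad point lowers the increment of [N] by at least 1 on both halves, so after at
    most [n] levels of bisection no bad point is left, with at most [2 ^ n] pieces. Thus the bad
    points need not be listed or sorted. *)
Lemma bound_by_splitting (E N : R -> R) (bad : R -> Prop) (a b err : R) :
  (forall c d, a <= c -> c <= d -> d <= b -> (forall e, c < e < d -> ~ bad e) ->
     Rabs (E d - E c) <= err) ->
  (forall c e d, c < e < d -> bad e -> N c + 1 <= N e /\ N e + 1 <= N d) ->
  forall n c d, a <= c -> c <= d -> d <= b -> N d - N c <= INR n ->
    Rabs (E d - E c) <= 2 ^ n * err.
Proof.
  intros Hfree Hsplit n. induction n as [|n IH]; intros c d Hac Hcd Hdb HN.
  - simpl. rewrite Rmult_1_l. apply Hfree; try assumption. intros e He Hb.
    destruct (Hsplit c e d He Hb). simpl in HN. lra.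
  - destruct (classic (exists e, c < e < d /\ bad e)) as [[e [He Hb]]|Hno].
    + destruct (Hsplit c e d He Hb). rewrite S_INR in HN.
      pose proof (IH c e ltac:(lra) ltac:(lra) ltac:(lra) ltac:(lra)).
      pose proof (IH e d ltac:(lra) ltac:(lra) ltac:(lra) ltac:(lra)).
      replace (E d - E c) with ((E d - E e) + (E e - E c)) by ring.
      eapply Rle_trans; [apply Rabs_triang|]. simpl. lra.
    + assert (H : Rabs (E d - E c) <= err).
      { apply Hfree; try assumption. intros e He Hb. apply Hno. eauto. }
      pose proof (Rabs_pos (E d - E c)).
      assert (1 <= 2 ^ S n) by (apply pow_R1_Rle; lra). nra.
Qed.

(** On a piece of length at least [s * delta], the comparison at both ends involves the same step
    sums at [c], which cancel. On a shorter piece the Lipschitz bounds alone suffice. *)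
Lemma break_free_comparison (F1 F2 H Phi1 Phi2 : R -> R) (J1 J2 : list (R * R))
    (K1 K2 L1 L2 : R) (r : nat) (c d l s delta Lam V eta : R) :
  break_lift F1 Phi1 J1 K1 L1 -> break_lift F2 Phi2 J2 K2 L2 ->
  continuity H -> (forall y z, y < z -> H y < H z) ->
  (forall y, H (Nat.iter r F1 y) = Nat.iter r F2 (H y)) ->
  0 < l -> 0 < s -> 0 < delta -> 0 <= Lam -> 0 <= V -> 0 <= eta <= 1 / 2 -> c <= d ->
  (forall y z, c <= y <= d -> c <= z <= d ->
     Rabs (orbit_sum F1 Phi1 r z - orbit_sum F1 Phi1 r y) <= Lam * Rabs (z - y) / delta) ->
  (forall y z, c <= y <= d -> c <= z <= d ->
     Rabs (orbit_sum F2 Phi2 r (H z) - orbit_sum F2 Phi2 r (H y))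
     <= Lam * Rabs (H z - H y) / delta) ->
  (forall y, c < y < d -> ~ hits_break F1 J1 r y /\ ~ hits_break F2 J2 r (H y)) ->
  (forall y, - V <= log_deriv F1 Phi1 J1 r y) ->
  (forall y z, c <= y <= d -> c <= z <= d ->
     near_affine H l (eta * l * s * exp (- V) * delta) z y /\
     near_affine H l (eta * l * s * exp (- V) * delta) (Nat.iter r F1 z) (Nat.iter r F1 y)) ->
  Rabs ((orbit_sum F1 Phi1 r d - orbit_sum F2 Phi2 r (H d))
        - (orbit_sum F1 Phi1 r c - orbit_sum F2 Phi2 r (H c)))
  <= 2 * (Lam * s * (1 + 2 * l)) + 6 * eta.
Proof.
  intros HF1 HF2 Hc Hi Hconj Hl Hs Hd HLam HV Heta Hcd Lip1 Lip2 Hfree Hlow Haff.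
  assert (Hsd : 0 < s * delta) by nra.
  assert (HLs : 0 <= Lam * s) by nra.
  destruct (Rle_or_lt (c + s * delta) d) as [Hlong|Hshort].
  - assert (EC : forall a e, c <= a -> a + s * delta <= d -> a <= e <= a + s * delta -> _)
      by (intros a e Ha Ha' He;
          exact (break_free_end_comparison F1 F2 H Phi1 Phi2 J1 J2 K1 K2 L1 L2 r c d a e l s
            delta Lam V eta HF1 HF2 Hc Hi Hconj Hl Hs Hd HLam HV Heta Ha Ha' He Lip1 Lip2
            Hfree Hlow Haff)).
    pose proof (EC c c ltac:(lra) ltac:(lra) ltac:(lra)) as B1.
    pose proof (EC (d - s * delta) d ltac:(lra) ltac:(lra) ltac:(lra)) as B2.
    apply Rabs_le_elim in B1. apply Rabs_le_elim in B2. apply Rabs_le. lra.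
  - pose proof (Lip1 c d ltac:(lra) ltac:(lra)) as B1.
    pose proof (Lip2 c d ltac:(lra) ltac:(lra)) as B2.
    destruct (Haff c d ltac:(lra) ltac:(lra)) as [A _]. unfold near_affine in A.
    assert (EV : exp (- V) <= 1).
    { rewrite <- exp_0. destruct HV as [?|<-]; [left; apply exp_increasing; lra|].
      rewrite Ropp_0; lra. }
    pose proof (exp_pos (- V)) as PV.
    assert (Hdelta : eta * l * s * exp (- V) * delta <= l * (s * delta)).
    { replace (eta * l * s * exp (- V) * delta) with ((eta * exp (- V)) * (l * (s * delta))) by ring.
      assert (eta * exp (- V) <= 1) by nra. assert (0 <= l * (s * delta)) by nra. nra. }
    assert (HH : Rabs (H d - H c) <= 2 * l * (s * delta)).
    { apply Rabs_le_elim in A. apply Rabs_le.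
      assert (0 <= l * (d - c) <= l * (s * delta)) by (split; nra). nra. }
    assert (C : forall u m, u <= m * (s * delta) -> Lam * u / delta <= Lam * s * m).
    { intros u m Hu. replace (Lam * s * m) with (Lam * (m * (s * delta)) / delta) by (field; lra).
      unfold Rdiv. apply Rmult_le_compat_r; [left; now apply Rinv_0_lt_compat|].
      now apply Rmult_le_compat_l. }
    pose proof (C _ (2 * l) HH) as C2.
    pose proof (C (Rabs (d - c)) 1 ltac:(rewrite Rabs_right; lra)) as C1.
    assert (0 <= Lam * s * (2 * l)) by (apply Rmult_le_pos; lra).
    assert (B1' := Rle_trans _ _ _ B1 C1). assert (B2' := Rle_trans _ _ _ B2 C2).
    apply Rabs_le_elim in B1'. apply Rabs_le_elim in B2'. apply Rabs_le. lra.
Qed.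

Lemma iter_conjugacy (F1 F2 H : R -> R) :
  (forall y, H (F1 y) = F2 (H y)) -> forall n y, H (Nat.iter n F1 y) = Nat.iter n F2 (H y).
Proof. intros E n y. induction n as [|n IH]; simpl; [reflexivity|]. now rewrite E, IH. Qed.

(** Differentiability at the single point [x] controls increments between two other points only
    relative to their distance [m] from [x], not to [|y - z|]. This is why a fixed proportion [s] of
    the scale is used for the test intervals. *)
Lemma derivable_near_affine (H : R -> R) (x l : R) :
  derivable_pt_lim H x l -> forall eps, 0 < eps ->
  exists d, 0 < d /\ forall y z m, Rabs (y - x) <= m -> Rabs (z - x) <= m -> m < d ->
    near_affine H l (2 * eps * m) y z.
Proof.
  intros HD eps He. destruct (HD eps He) as [d Hd]. exists d. split; [apply cond_pos|].
  assert (H1 : forall y m, Rabs (y - x) <= m -> m < d ->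
             Rabs (H y - H x - l * (y - x)) <= eps * m).
  { intros y m Hy Hm. destruct (Req_dec y x) as [->|Hne].
    - rewrite !Rminus_diag, Rmult_0_r, Rminus_0_r, Rabs_R0.
      pose proof (Rabs_pos (x - x)). nra.
    - specialize (Hd (y - x) ltac:(lra) ltac:(lra)).
      replace (x + (y - x)) with y in Hd by ring.
      replace (H y - H x - l * (y - x)) with (((H y - H x) / (y - x) - l) * (y - x))
        by (field; lra).
      rewrite Rabs_mult. apply Rmult_le_compat; try apply Rabs_pos; lra. }
  intros y z m Hy Hz Hm. unfold near_affine.
  pose proof (H1 y m Hy Hm) as A. pose proof (H1 z m Hz Hm) as B.
  apply Rabs_le_elim in A. apply Rabs_le_elim in B. apply Rabs_le. lra.
Qed.

Lemma log_total_jump_eq (F1 F2 H Phi1 Phi2 : R -> R) (J1 J2 : list (R * R))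
    (K1 K2 L1 L2 rho x l : R) :
  break_lift F1 Phi1 J1 K1 L1 -> break_lift F2 Phi2 J2 K2 L2 ->
  rotation_number F1 rho -> rotation_number F2 rho -> irrational rho ->
  continuity H -> (forall y z, y < z -> H y < H z) -> (forall y, H (y + 1) = H y + 1) ->
  (forall y, H (F1 y) = F2 (H y)) ->
  derivable_pt_lim H x l -> 0 < l -> L1 = L2.
Proof.
  intros HF1 HF2 Hr1 Hr2 Hirr Hc Hi Hs Hconj HD Hl.
  pose proof HF1 as [HC1 [HK1 [_ [_ [HP1 _]]]]]. pose proof HC1 as [_ [Hi1 Hs1]].
  pose proof HF2 as [HC2 [HK2 [_ [_ [HP2 _]]]]]. pose proof HC2 as [_ [Hi2 Hs2]].
  apply NNPP. intros Hne. set (tau := Rabs (L1 - L2)).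
  assert (Htau : 0 < tau) by (apply Rabs_pos_lt; lra).
  set (D1 := distortion_bound J1 K1). set (D2 := distortion_bound J2 K2).
  assert (HD1 : 0 <= D1) by now apply distortion_bound_nonneg.
  assert (HD2 : 0 <= D2) by now apply distortion_bound_nonneg.
  set (V := 2 * D1). assert (HV : 0 <= V) by (unfold V; lra).
  pose (C1 := 2 * K1 * exp (2 * D1)). pose (C2 := 2 * K2 * exp (2 * D2)).
  assert (HC1' : 0 <= C1) by (unfold C1; pose proof (exp_pos (2 * D1)); nra).
  assert (HC2' : 0 <= C2) by (unfold C2; pose proof (exp_pos (2 * D2)); nra).
  (* A common Lipschitz constant relative to [delta]: for [F2] the natural scale is [H b - H a],
     which is at least [l * delta / 2]. *)
  set (Lam := C1 + 2 * C2 / l).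
  assert (H2C : 0 <= 2 * C2 / l) by (apply Rle_mult_inv_pos; lra).
  assert (HLam : 0 <= Lam) by (unfold Lam; lra).
  (* Multiplicity 2 times the increment [2 * length] of [break_count] per period, for each map. *)
  set (n := (4 * length J1 + 4 * length J2)%nat).
  set (P := 2 ^ n). assert (HP : 1 <= P) by (unfold P; apply pow_R1_Rle; lra).
  set (M := 16 * P * (Lam + 1) * (1 + 2 * l)).
  assert (HM : 0 < M) by (unfold M; repeat apply Rmult_lt_0_compat; lra).
  (* This gives both [s <= 1] and [s * M <= tau]. *)
  set (s := tau / (tau + M)).
  assert (Hs0 : 0 < s) by (unfold s; apply Rdiv_lt_0_compat; lra).
  assert (Es : s * (tau + M) = tau) by (unfold s; field; lra).
  assert (Hs1' : s <= 1) by nra.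
  clearbody s.
  set (eta := Rmin (1 / 2) (tau / (64 * P))).
  assert (Heta : 0 < eta /\ eta <= 1 / 2 /\ eta * (64 * P) <= tau).
  { assert (0 < tau / (64 * P)) by (apply Rdiv_lt_0_compat; lra).
    unfold eta. split; [apply Rmin_glb_lt; lra|]. split; [apply Rmin_l|].
    apply Rle_trans with (tau / (64 * P) * (64 * P)); [|right; field; lra].
    apply Rmult_le_compat_r; [lra|apply Rmin_r]. }
  clearbody eta.
  set (err := 2 * (Lam * s * (1 + 2 * l)) + 6 * eta).
  (* [L1 - L2] is made of two increments, over [[a, x]] and over [[x, b]], each known up to
     [P * err]. *)
  assert (Herr : P * err < tau / 2).
  { unfold err.
    assert (E : P * (2 * (Lam * s * (1 + 2 * l))) <= tau / 8).
    { apply Rle_trans with (s * M / 8); [|nra]. unfold M.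
      replace (s * (16 * P * (Lam + 1) * (1 + 2 * l)) / 8) with
        (P * (2 * ((Lam + 1) * s * (1 + 2 * l)))) by field.
      apply Rmult_le_compat_l; [lra|]. apply Rmult_le_compat_l; [lra|].
      apply Rmult_le_compat_r; [lra|]. nra. }
    destruct Heta as [_ [_ Heta]].
    replace (P * (2 * (Lam * s * (1 + 2 * l)) + 6 * eta)) with
      (P * (2 * (Lam * s * (1 + 2 * l))) + 6 / 64 * (eta * (64 * P))) by field.
    lra. }
  set (eps := eta * l * s * exp (- V)).
  pose proof (exp_pos (- V)) as PmV. pose proof (exp_pos V) as PV.
  assert (Heps : 0 < eps) by (unfold eps; repeat apply Rmult_lt_0_compat; lra).
  assert (EV : exp (- V) <= 1).
  { rewrite <- exp_0. destruct HV as [?|<-]; [left; apply exp_increasing; lra|].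
    rewrite Ropp_0; lra. }
  assert (Hepsl : eps <= l / 2).
  { unfold eps. replace (l / 2) with (1 / 2 * l * 1 * 1) by field.
    repeat apply Rmult_le_compat; repeat apply Rmult_le_pos; lra. }
  (* A return map moves [x] by at most [delta] and stretches by at most [exp V], so the image of
     [[a, b]] stays within [A * delta] of [x]. *)
  set (A := exp V + 1).
  destruct (derivable_near_affine H x l HD (eps / (2 * A))) as [d0 [Hd0 Haff0]].
  { apply Rdiv_lt_0_compat; unfold A; lra. }
  destruct (small_close_returns F1 Phi1 J1 K1 L1 rho HF1 Hr1 Hirr (d0 / A))
    as [q [p [q' [p' [Hcp Hsmall]]]]].
  { apply Rdiv_lt_0_compat; unfold A; lra. }
  pose proof (convergent_pair_close_returns F1 rho q q' p p' HC1 Hr1 Hcp) as HR1.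
  pose proof (convergent_pair_close_returns F2 rho q q' p p' HC2 Hr2 Hcp) as HR2.
  pose proof HR1 as [Hqq [Hdet Hord1]]. pose proof HR2 as [_ [_ Hord2]].
  assert (Hret : forall r m y, H (return_map F1 r m y) = return_map F2 r m (H y)).
  { intros r m y. unfold return_map, Rminus.
    rewrite <- opp_IZR, (shift_IZR H 1 Hs), (iter_conjugacy F1 F2 H Hconj). ring. }
  specialize (Hsmall x). destruct (Hord1 x) as [O1 [O2 _]].
  set (a := return_map F1 q' p' x) in *. set (b := return_map F1 q p x) in *.
  assert (Ha : H a = return_map F2 q' p' (H x)) by apply Hret.
  assert (Hb : H b = return_map F2 q p (H x)) by apply Hret.
  set (delta := b - a) in *. assert (Hdelta : 0 < delta) by (unfold delta; lra).
  assert (HAd : A * delta < d0).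
  { replace d0 with (A * (d0 / A)) by (field; unfold A; lra).
    apply Rmult_lt_compat_l; [unfold A; lra|exact Hsmall]. }
  assert (Haff : forall y z, Rabs (y - x) <= A * delta -> Rabs (z - x) <= A * delta ->
            near_affine H l (eps * delta) y z).
  { intros y z Hy Hz. pose proof (Haff0 y z (A * delta) Hy Hz HAd) as N.
    replace (2 * (eps / (2 * A)) * (A * delta)) with (eps * delta) in N
      by (field; unfold A; lra). exact N. }
  assert (HA1 : 1 <= A) by (unfold A; lra).
  assert (Hnear : forall y, a <= y <= b -> Rabs (y - x) <= A * delta).
  { intros y Hy. apply Rle_trans with delta; [|nra]. apply Rabs_le. unfold delta; lra. }
  assert (Hdelta2 : l * delta / 2 <= H b - H a).
  { pose proof (Haff b a (Hnear b ltac:(lra)) (Hnear a ltac:(lra))) as N.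
    unfold near_affine in N. fold delta in N. apply Rabs_le_elim in N. nra. }
  assert (Hle : forall y z, y <= z -> H y <= H z).
  { intros y z [?| ->]; [left; auto|lra]. }
  assert (Main : forall r m, (r = q /\ m = p) \/ (r = q' /\ m = p') ->
    forall c d, a <= c -> c <= d -> d <= b ->
    Rabs ((orbit_sum F1 Phi1 r d - orbit_sum F2 Phi2 r (H d))
          - (orbit_sum F1 Phi1 r c - orbit_sum F2 Phi2 r (H c))) <= P * err).
  { intros r m Hrm.
    assert (Hrq : (r <= q)%nat) by (destruct Hrm as [[-> _]|[-> _]]; lia).
    assert (Hr : r = q \/ r = q') by tauto.
    assert (Hret_near : a <= return_map F1 r m x <= b).
    { destruct Hrm as [[-> ->]|[-> ->]]; fold a b; lra. }
    assert (Hden : forall y, - V <= log_deriv F1 Phi1 J1 r y <= V).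
    { intros y. pose proof (denjoy_inequality F1 Phi1 J1 K1 L1 q q' p p' HF1 HR1 r Hr y) as B.
      apply Rabs_le_elim in B. exact B. }
    assert (Himg : forall y, a <= y <= b -> Rabs (return_map F1 r m y - x) <= A * delta).
    { assert (I : forall y z, y <= z ->
         0 <= return_map F1 r m z - return_map F1 r m y <= exp V * (z - y)).
      { intros y z Hyz. unfold return_map.
        pose proof (iter_increment_le F1 Phi1 J1 K1 L1 HF1 r y z V Hyz
          ltac:(intros w _; apply Hden)).
        pose proof (iter_le F1 Hi1 r y z Hyz). lra. }
      intros y Hy. unfold A. apply Rabs_le.
      destruct (Rle_or_lt x y) as [Hxy|Hxy].
      - pose proof (I x y Hxy). assert (exp V * (y - x) <= exp V * delta)
          by (apply Rmult_le_compat_l; unfold delta; lra). unfold delta in *. lra.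
      - pose proof (I y x ltac:(lra)). assert (exp V * (x - y) <= exp V * delta)
          by (apply Rmult_le_compat_l; unfold delta; lra). unfold delta in *. lra. }
    (* The iterates differ from the return maps by the integer [m], which commutes with [H] and
       drops out of increments. *)
    assert (Haff_img : forall y z, a <= y <= b -> a <= z <= b ->
      near_affine H l (eps * delta) (Nat.iter r F1 z) (Nat.iter r F1 y)).
    { intros y z Hy Hz. pose proof (Haff _ _ (Himg z Hz) (Himg y Hy)) as N.
      unfold near_affine in *. rewrite !Hret in N. unfold return_map in N.
      rewrite !(iter_conjugacy F1 F2 H Hconj).
      match goal with |- Rabs ?u <= _ => match type of N with Rabs ?v <= _ =>
        replace u with v by ring end end. exact N. }
    assert (Lip1 : forall y z, a <= y <= b -> a <= z <= b ->
      Rabs (orbit_sum F1 Phi1 r z - orbit_sum F1 Phi1 r y) <= Lam * Rabs (z - y) / delta).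
    { intros y z Hy Hz.
      pose proof (orbit_sum_lipschitz F1 Phi1 J1 K1 L1 q q' p p' HF1 HR1 x y z r Hrq Hy Hz) as B.
      fold D1 C1 a b delta in B. eapply Rle_trans; [exact B|].
      unfold Rdiv. apply Rmult_le_compat_r; [left; now apply Rinv_0_lt_compat|].
      apply Rmult_le_compat_r; [apply Rabs_pos|unfold Lam; lra]. }
    assert (Lip2 : forall y z, a <= y <= b -> a <= z <= b ->
      Rabs (orbit_sum F2 Phi2 r (H z) - orbit_sum F2 Phi2 r (H y))
      <= Lam * Rabs (H z - H y) / delta).
    { intros y z Hy Hz.
      pose proof (orbit_sum_lipschitz F2 Phi2 J2 K2 L2 q q' p p' HF2 HR2 (H x) (H y) (H z) r Hrq)
        as B.
      rewrite <- Ha, <- Hb in B.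
      specialize (B (conj (Hle a y ltac:(lra)) (Hle y b ltac:(lra)))
                    (conj (Hle a z ltac:(lra)) (Hle z b ltac:(lra)))).
      fold D2 C2 in B. eapply Rle_trans; [exact B|].
      pose proof (Rabs_pos (H z - H y)) as PA.
      apply Rle_trans with (C2 * Rabs (H z - H y) / (l * delta / 2)).
      - unfold Rdiv at 1. unfold Rdiv at 1. apply Rmult_le_compat_l; [nra|].
        apply Rinv_le_contravar; [nra|exact Hdelta2].
      - replace (C2 * Rabs (H z - H y) / (l * delta / 2)) with
          (2 * C2 / l * Rabs (H z - H y) / delta) by (field; lra).
        unfold Rdiv at 1 3. apply Rmult_le_compat_r; [left; now apply Rinv_0_lt_compat|].
        apply Rmult_le_compat_r; [exact PA|unfold Lam; lra]. }
    pose (N := fun y => orbit_sum F1 (break_count J1) r y + orbit_sum F2 (break_count J2) r (H y)).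
    assert (HN : forall c d, a <= c -> c <= d -> d <= b -> N d - N c <= INR n).
    { assert (Hcount : forall F J, circle_lift F -> close_returns F q p q' p' ->
        forall w y z, return_map F q' p' w <= y -> y <= z -> z <= return_map F q p w ->
        orbit_sum F (break_count J) r z - orbit_sum F (break_count J) r y
        <= 4 * INR (length J)).
      { intros F J HC HR w y z Hy Hyz Hz. pose proof HC as [_ [HiF _]].
        pose proof (orbit_sum_multiplicity F (break_count J) _ q q' p p' HC HR
          (break_count_le J) (break_count_shift J) w y z ltac:(lra) ltac:(lra)) as B.
        pose proof (orbit_sum_increment_le F (break_count J) (break_count J) q r y z Hrq) as B'.
        eapply Rle_trans; [apply Rle_abs|]. eapply Rle_trans; [apply B'|lra].
        intros i _. pose proof (break_count_le J _ _ (iter_le F HiF i y z Hyz)).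
        rewrite Rabs_right; lra. }
      intros c d Hac Hcd Hdb. unfold N, n. rewrite plus_INR, !mult_INR.
      change (INR 4) with (((1 + 1) + 1) + 1).
      pose proof (Hcount F1 J1 HC1 HR1 x c d Hac Hcd Hdb).
      pose proof (Hcount F2 J2 HC2 HR2 (H x) (H c) (H d)) as B2.
      rewrite <- Ha, <- Hb in B2. specialize (B2 (Hle _ _ Hac) (Hle _ _ Hcd) (Hle _ _ Hdb)).
      lra. }
    intros c d Hac Hcd Hdb.
    apply (bound_by_splitting
      (fun y => orbit_sum F1 Phi1 r y - orbit_sum F2 Phi2 r (H y)) N
      (fun y => hits_break F1 J1 r y \/ hits_break F2 J2 r (H y)) a b err); try assumption.
    - intros c' d' Hac' Hcd' Hdb' Hno. unfold err.
      apply (break_free_comparison F1 F2 H Phi1 Phi2 J1 J2 K1 K2 L1 L2 r c' d' l s delta Lam V eta);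
        try assumption; try lra.
      + apply iter_conjugacy, Hconj.
      + intros y z Hy Hz. apply Lip1; lra.
      + intros y z Hy Hz. apply Lip2; lra.
      + intros y Hy. specialize (Hno y Hy). tauto.
      + intros y. apply Hden.
      + intros y z Hy Hz. fold eps. split; [|apply Haff_img; lra].
        apply Haff; apply Hnear; lra.
    - intros c' e d' He Hbad. unfold N.
      pose proof (orbit_sum_le F1 (break_count J1) Hi1 (break_count_le J1) r) as M1.
      pose proof (orbit_sum_le F2 (break_count J2) Hi2 (break_count_le J2) r) as M2.
      pose proof (M1 c' e ltac:(lra)). pose proof (M1 e d' ltac:(lra)).
      pose proof (M2 (H c') (H e) (Hle c' e ltac:(lra))).
      pose proof (M2 (H e) (H d') (Hle e d' ltac:(lra))).
      destruct Hbad as [Hbad|Hbad].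
      + pose proof (orbit_break_count_split F1 J1 r c' e d' Hi1 Hbad He). lra.
      + pose proof (orbit_break_count_split F2 J2 r (H c') (H e) (H d') Hi2 Hbad
          (conj (Hi _ _ (proj1 He)) (Hi _ _ (proj2 He)))). lra.
    - now apply HN. }
  pose proof (orbit_sum_chain F1 Phi1 L1 q q' p p' Hs1 HP1 Hdet x) as E1.
  pose proof (orbit_sum_chain F2 Phi2 L2 q q' p p' Hs2 HP2 Hdet (H x)) as E2.
  rewrite <- Ha, <- Hb in E2. fold a b in E1.
  pose proof (Main q p ltac:(tauto) a x ltac:(lra) ltac:(lra) ltac:(lra)) as B1.
  pose proof (Main q' p' ltac:(tauto) x b ltac:(lra) ltac:(lra) ltac:(lra)) as B2.
  assert (tau <= 2 * (P * err)); [|lra].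
  unfold tau. apply Rabs_le_elim in B1. apply Rabs_le_elim in B2. apply Rabs_le. lra.
Qed.

(** * Regularity of the logarithmic derivative *)

Lemma right_deriv_unique (F : R -> R) (x l l' : R) :
  right_deriv F x l -> right_deriv F x l' -> l = l'.
Proof.
  intros H H'. apply NNPP. intros Hne.
  assert (He : 0 < Rabs (l - l') / 2) by (pose proof (Rabs_pos_lt (l - l')); lra).
  destruct (H _ He) as [d [Hd Hd']]. destruct (H' _ He) as [e [He0 He']].
  pose proof (Rmin_l d e). pose proof (Rmin_r d e).
  assert (0 < Rmin d e) by (apply Rmin_glb_lt; lra).
  specialize (Hd' (Rmin d e / 2) ltac:(lra)). specialize (He' (Rmin d e / 2) ltac:(lra)).
  apply Rabs_def2 in Hd'. apply Rabs_def2 in He'.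
  pose proof (Rabs_right (l - l')). pose proof (Rabs_left (l - l')).
  destruct (Rlt_le_dec (l - l') 0); lra.
Qed.

Lemma left_deriv_reflect (F : R -> R) (x l : R) :
  left_deriv F x l <-> right_deriv (fun y => - F (- y)) (- x) l.
Proof.
  assert (E : forall h, 0 < h ->
    (- F (- (- x + h)) - - F (- - x)) / h = (F (x - h) - F x) / - h).
  { intros h Hh. replace (- (- x + h)) with (x - h) by ring. rewrite Ropp_involutive.
    field. lra. }
  split; intros H e He; destruct (H e He) as [d [Hd Hd']]; exists d; split; try exact Hd;
    intros h Hh; specialize (Hd' h Hh); rewrite E in * by lra; exact Hd'.
Qed.

Lemma left_deriv_unique (F : R -> R) (x l l' : R) :
  left_deriv F x l -> left_deriv F x l' -> l = l'.
Proof. rewrite !left_deriv_reflect. apply right_deriv_unique. Qed.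

Lemma right_deriv_shift (F : R -> R) (x l : R) (k : Z) :
  (forall x, F (x + 1) = F x + 1) -> right_deriv F x l -> right_deriv F (x + IZR k) l.
Proof.
  intros Hs H e He. destruct (H e He) as [d [Hd Hd']]. exists d; split; [exact Hd|].
  intros h Hh. replace (x + IZR k + h) with (x + h + IZR k) by ring.
  rewrite !(shift_IZR F 1 Hs). replace (F (x + h) + IZR k * 1 - (F x + IZR k * 1)) with
    (F (x + h) - F x) by ring. now apply Hd'.
Qed.

Lemma left_deriv_shift (F : R -> R) (x l : R) (k : Z) :
  (forall x, F (x + 1) = F x + 1) -> left_deriv F x l -> left_deriv F (x + IZR k) l.
Proof.
  intros Hs H e He. destruct (H e He) as [d [Hd Hd']]. exists d; split; [exact Hd|].
  intros h Hh. replace (x + IZR k - h) with (x - h + IZR k) by ring.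
  rewrite !(shift_IZR F 1 Hs). replace (F (x - h) + IZR k * 1 - (F x + IZR k * 1)) with
    (F (x - h) - F x) by ring. now apply Hd'.
Qed.

Lemma derivable_one_sided (F : R -> R) (x l : R) :
  derivable_pt_lim F x l -> left_deriv F x l /\ right_deriv F x l.
Proof.
  intros H. split; intros e He; destruct (H e He) as [d Hd]; exists d;
    (split; [apply cond_pos|]); intros h Hh.
  - apply (Hd (- h)); [lra|]. rewrite Rabs_Ropp, Rabs_right; lra.
  - apply Hd; [lra|]. rewrite Rabs_right; lra.
Qed.

Lemma mean_value_open (F f : R -> R) (a b : R) :
  a < b -> continuity F -> (forall c, a < c < b -> derivable_pt_lim F c (f c)) ->
  exists c, a < c < b /\ F b - F a = f c * (b - a).
Proof.
  intros Hab Hc Hd.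
  destruct (MVT F id a b (fun c Hc => exist _ (f c) (Hd c Hc))
    (fun c _ => derivable_pt_id c) Hab (fun c _ => Hc c)
    (fun c _ => derivable_continuous_pt _ _ (derivable_pt_id c))) as [c [Hcc E]].
  exists c. split; [exact Hcc|]. rewrite derive_pt_id in E. unfold id in E. simpl in E. lra.
Qed.

(** By the mean value theorem a difference quotient at [p] is a value of [f] close to [p], so the
    one-sided derivative extends the Lipschitz function [f] to the end point. *)
Lemma right_deriv_limit (F f : R -> R) (p d l M : R) :
  continuity F -> (forall c, p < c < p + d -> derivable_pt_lim F c (f c)) ->
  right_deriv F p l ->
  (forall u v, p < u < p + d -> p < v < p + d -> Rabs (f u - f v) <= M * Rabs (u - v)) ->
  forall u, p < u < p + d -> Rabs (l - f u) <= M * (u - p).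
Proof.
  intros Hc Hd Hl HM u Hu. apply le_epsilon. intros e He.
  destruct (Hl e He) as [d' [Hd' Hd'']].
  set (h := Rmin (d' / 2) (u - p)).
  assert (Hh : 0 < h < d' /\ h <= u - p).
  { unfold h, Rmin. destruct (Rle_dec (d' / 2) (u - p)); lra. }
  specialize (Hd'' h ltac:(lra)).
  destruct (mean_value_open F f p (p + h) ltac:(lra) Hc) as [c [Hcc E]].
  { intros c Hcc. apply Hd. lra. }
  replace ((F (p + h) - F p) / h) with (f c) in Hd'' by (rewrite E; field; lra).
  assert (HM0 : 0 <= M).
  { pose proof (HM u ((p + u) / 2) ltac:(lra) ltac:(lra)) as B.
    pose proof (Rabs_pos (f u - f ((p + u) / 2))).
    rewrite (Rabs_right (u - (p + u) / 2)) in B by lra. nra. }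
  pose proof (HM c u ltac:(lra) ltac:(lra)) as B.
  assert (B' : M * Rabs (c - u) <= M * (u - p)).
  { apply Rmult_le_compat_l; [exact HM0|]. apply Rabs_le; lra. }
  replace (l - f u) with (- (f c - l) + (f c - f u)) by ring.
  eapply Rle_trans; [apply Rabs_triang|]. rewrite Rabs_Ropp. lra.
Qed.

Lemma left_deriv_limit (F f : R -> R) (p d l M : R) :
  continuity F -> (forall c, p - d < c < p -> derivable_pt_lim F c (f c)) ->
  left_deriv F p l ->
  (forall u v, p - d < u < p -> p - d < v < p -> Rabs (f u - f v) <= M * Rabs (u - v)) ->
  forall u, p - d < u < p -> Rabs (l - f u) <= M * (p - u).
Proof.
  intros Hc Hd Hl HM u Hu.
  assert (Hopp : continuity (fun y => - y)).
  { apply derivable_continuous, (derivable_opp id), derivable_id. }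
  replace (f u) with (f (- - u)) by (now rewrite Ropp_involutive).
  replace (p - u) with (- u - - p) by ring.
  apply (right_deriv_limit (fun y => - F (- y)) (fun y => f (- y)) (- p) d l M).
  - apply (continuity_opp (fun y => F (- y))), (continuity_comp _ F Hopp Hc).
  - intros c Hcc. replace (f (- c)) with (- (f (- c) * -1)) by ring.
    apply (derivable_pt_lim_opp (fun y => F (- y))).
    apply (derivable_pt_lim_comp (fun y => - y) F); [|apply Hd; lra].
    apply (derivable_pt_lim_opp id), derivable_pt_lim_id.
  - now apply left_deriv_reflect.
  - intros v w Hv Hw. replace (v - w) with (- (- v - - w)) by ring. rewrite Rabs_Ropp.
    apply HM; lra.
  - lra.
Qed.

Definition lipschitz_on (g : R -> R) (M a b : R) : Prop :=
  forall u v, a <= u <= b -> a <= v <= b -> Rabs (g u - g v) <= M * Rabs (u - v).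

Lemma lipschitz_glue (g : R -> R) (M a b c : R) :
  a <= b -> b <= c -> lipschitz_on g M a b -> lipschitz_on g M b c -> lipschitz_on g M a c.
Proof.
  intros Hab Hbc H1 H2.
  assert (H : forall u v, a <= u -> u <= v -> v <= c -> Rabs (g u - g v) <= M * Rabs (u - v)).
  { intros u v Hu Huv Hv.
    destruct (Rle_or_lt v b) as [?|?]; [apply H1; lra|].
    destruct (Rle_or_lt b u) as [?|?]; [apply H2; lra|].
    pose proof (H1 u b ltac:(lra) ltac:(lra)) as B1.
    pose proof (H2 b v ltac:(lra) ltac:(lra)) as B2.
    rewrite (Rabs_left (u - b)) in B1 by lra. rewrite (Rabs_left (b - v)) in B2 by lra.
    rewrite (Rabs_left (u - v)) by lra.
    replace (g u - g v) with ((g u - g b) + (g b - g v)) by ring.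
    eapply Rle_trans; [apply Rabs_triang|]. lra. }
  intros u v Hu Hv. destruct (Rle_or_lt u v) as [?|?]; [apply H; lra|].
  rewrite Rabs_minus_sym, (Rabs_minus_sym u). apply H; lra.
Qed.

Lemma lipschitz_weaken (g : R -> R) (M M' a b a' b' : R) :
  M <= M' -> a <= a' -> b' <= b -> lipschitz_on g M a b -> lipschitz_on g M' a' b'.
Proof.
  intros HM Ha Hb H u v Hu Hv. eapply Rle_trans; [apply H; lra|].
  apply Rmult_le_compat_r; [apply Rabs_pos|exact HM].
Qed.

(** The two sides of a point are separate hypotheses because near a break [Phi] is described by
    different one-sided derivatives. *)
Lemma lipschitz_from_local (g : R -> R) :
  (forall p, exists d M, 0 < d /\ lipschitz_on g M p (p + d)) ->
  (forall p, exists d M, 0 < d /\ lipschitz_on g M (p - d) p) ->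
  forall a b, a <= b -> exists M, lipschitz_on g M a b.
Proof.
  intros Hr Hl a b Hab.
  apply (real_induction (fun t => exists M, lipschitz_on g M a t) a b Hab).
  - exists 0. intros u v Hu Hv. replace u with v by lra.
    rewrite !Rminus_diag, Rabs_R0; lra.
  - intros x Hx [M HM]. destruct (Hr x) as [d [M' [Hd HM']]]. exists d; split; [exact Hd|].
    intros y Hy _. exists (Rmax M M'). apply (lipschitz_glue g _ a x y); try lra.
    + apply (lipschitz_weaken g M _ a x); try lra; [apply Rmax_l|exact HM].
    + apply (lipschitz_weaken g M' _ x (x + d)); try lra; [apply Rmax_r|exact HM'].
  - intros x Hx HM. destruct (Hl x) as [d [M' [Hd HM']]].
    set (y := Rmax a (x - d / 2)).
    assert (Hy : a <= y < x /\ x - d < y).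
    { unfold y, Rmax. destruct (Rle_dec a (x - d / 2)); lra. }
    destruct (HM y ltac:(lra)) as [M HMy]. exists (Rmax M M').
    apply (lipschitz_glue g _ a y x); try lra.
    + apply (lipschitz_weaken g M _ a y); try lra; [apply Rmax_l|exact HMy].
    + apply (lipschitz_weaken g M' _ (x - d) x); try lra; [apply Rmax_r|exact HM'].
Qed.

Lemma lipschitz_from_period (g : R -> R) (L M : R) :
  (forall x, g (x + 1) = g x + L) -> lipschitz_on g M 0 1 ->
  forall x y, Rabs (g x - g y) <= M * Rabs (x - y).
Proof.
  intros Hg HM.
  assert (Hk : forall k : Z, lipschitz_on g M (IZR k) (IZR k + 1)).
  { intros k u v Hu Hv. specialize (HM (u - IZR k) (v - IZR k) ltac:(lra) ltac:(lra)).
    replace u with (u - IZR k + IZR k) at 1 by ring.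
    replace v with (v - IZR k + IZR k) at 1 by ring.
    rewrite !(shift_IZR g L Hg).
    replace (u - v) with (u - IZR k - (v - IZR k)) by ring.
    match goal with |- Rabs ?w <= _ => replace w with (g (u - IZR k) - g (v - IZR k)) by ring end.
    exact HM. }
  assert (Hn : forall (n : nat) k, lipschitz_on g M (IZR k) (IZR k + INR n)).
  { induction n as [|n IH]; intros k.
    - intros u v Hu Hv. simpl in *. replace u with v by lra.
      rewrite !Rminus_diag, Rabs_R0; lra.
    - rewrite S_INR. pose proof (pos_INR n). apply (lipschitz_glue g M _ (IZR k + INR n)); try lra.
      + apply IH.
      + specialize (Hk (k + Z.of_nat n)%Z). rewrite plus_IZR, <- INR_IZR_INZ in Hk.
        rewrite <- Rplus_assoc. exact Hk. }
  intros x y. set (k := Int_part (Rmin x y)).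
  pose proof (floor_spec (Rmin x y)) as Hf. unfold rfloor in Hf. fold k in Hf.
  destruct (INR_unbounded (Rmax x y - IZR k)) as [n HN].
  pose proof (Rmin_l x y). pose proof (Rmin_r x y).
  pose proof (Rmax_l x y). pose proof (Rmax_r x y).
  apply (Hn n k); lra.
Qed.

(** The bound [d <= 1] keeps the interval short enough for the Hoelder estimate and ensures that at
    most one lift of each break is crossed. *)
Lemma is_break_isolated (B : list R) (p : R) :
  exists d, 0 < d /\ d <= 1 /\ forall z, p - d < z < p + d -> z <> p -> ~ is_break B z.
Proof.
  induction B as [|b B [d [Hd [Hd1 IH]]]].
  - exists 1. split; [lra|]. split; [lra|]. intros z _ _ [b [k [[] _]]].
  - pose proof (floor_spec (p - b)) as Hf.
    assert (Hb : exists d, 0 < d /\ forall z, p - d < z < p + d -> z <> p ->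
                   forall k, z <> b + IZR k).
    { unfold rfloor in Hf. set (m := Int_part (p - b)) in *.
      destruct (Req_dec (p - b) (IZR m)) as [E|E].
      - exists 1. split; [lra|]. intros z Hz Hzp k ->.
        assert (m - 1 < k)%Z by (apply lt_IZR; rewrite minus_IZR; lra).
        assert (k < m + 1)%Z by (apply lt_IZR; rewrite plus_IZR; lra).
        assert (k = m) by lia. subst k. apply Hzp. lra.
      - exists (Rmin (p - b - IZR m) (IZR m + 1 - (p - b))).
        split; [apply Rmin_glb_lt; lra|]. intros z Hz Hzp k ->.
        pose proof (Rmin_l (p - b - IZR m) (IZR m + 1 - (p - b))).
        pose proof (Rmin_r (p - b - IZR m) (IZR m + 1 - (p - b))).
        assert (m < k)%Z by (apply lt_IZR; lra).
        assert (k < m + 1)%Z by (apply lt_IZR; rewrite plus_IZR; lra). lia. }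
    destruct Hb as [d' [Hd' Hb]]. pose proof (Rmin_l d d'). pose proof (Rmin_r d d').
    exists (Rmin d d'). split; [now apply Rmin_glb_lt|]. split; [lra|].
    intros z Hz Hzp [c [k [[->|Hin] E]]].
    + apply (Hb z ltac:(lra) Hzp k E).
    + apply (IH z ltac:(lra) Hzp). exists c, k. tauto.
Qed.

Definition break_jumps (B : list R) (s : R -> R) : list (R * R) := map (fun b => (b, s b)) B.

Lemma in_break_jumps (B : list R) (s : R -> R) (b t : R) :
  In (b, t) (break_jumps B s) -> In b B.
Proof.
  unfold break_jumps. rewrite in_map_iff. intros [c [E Hc]]. injection E as <- _. exact Hc.
Qed.

(** Breaks are distinct representatives in [[0, 1)], so only the entry [b0] has a lift at [p]; all
    other entries contribute the same at [u] and [p]. *)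
Lemma step_jump (B : list R) (s : R -> R) (b0 u p : R) (k0 : Z) :
  NoDup B -> (forall b, In b B -> 0 <= b < 1) -> In b0 B -> p = b0 + IZR k0 ->
  p - 1 <= u < p -> (forall z, u < z < p -> ~ is_break B z) ->
  step (break_jumps B s) p = step (break_jumps B s) u + s b0.
Proof.
  intros Hnd HB Hin Hp Hu Hno.
  assert (Hb0 : 0 <= b0 < 1) by (apply HB; exact Hin).
  assert (Hsame : forall b k, In b B -> p = b + IZR k -> b = b0).
  { intros b k Hb E. specialize (HB b Hb).
    assert (k - k0 < 1)%Z by (apply lt_IZR; rewrite minus_IZR; lra).
    assert (-1 < k - k0)%Z by (apply lt_IZR; rewrite minus_IZR; lra).
    assert (k = k0) by lia. subst k. lra. }
  assert (Hconst : forall B', (forall b, In b B' -> In b B /\ b <> b0) ->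
            step (break_jumps B' s) p = step (break_jumps B' s) u).
  { intros B' HB'. apply step_const; [lra|]. intros b t k Hb Hk.
    destruct (HB' b (in_break_jumps _ _ _ _ Hb)) as [HbB Hne].
    destruct (Req_dec (b + IZR k) p) as [E|E].
    - apply Hne, (Hsame b k HbB). lra.
    - apply (Hno (b + IZR k)); [lra|]. exists b, k. tauto. }
  assert (Hind : forall B', (forall b, In b B' -> In b B) -> NoDup B' -> In b0 B' ->
            step (break_jumps B' s) p = step (break_jumps B' s) u + s b0).
  { induction B' as [|c B' IH]; intros Hincl Hnd' Hin'; [destruct Hin'|].
    apply NoDup_cons_iff in Hnd'. destruct Hnd' as [Hc Hnd'].
    change (break_jumps (c :: B') s) with ((c, s c) :: break_jumps B' s).
    assert (Hcons : forall y, step ((c, s c) :: break_jumps B' s) y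
              = s c * rfloor (y - c) + step (break_jumps B' s) y) by reflexivity.
    rewrite !Hcons.
    destruct (Req_dec c b0) as [->|Hne].
    - rewrite (Hconst B').
      2:{ intros b Hb. split; [apply Hincl; right; exact Hb|]. intros ->. contradiction. }
      rewrite (floor_unique (p - b0) k0) by lra.
      rewrite (floor_unique (u - b0) (k0 - 1)) by (rewrite minus_IZR; lra).
      rewrite minus_IZR. ring.
    - destruct Hin' as [->|Hin']; [contradiction|].
      pose proof (Hconst (c :: nil)) as H1. unfold step in H1. simpl in H1.
      rewrite !Rplus_0_r in H1.
      rewrite H1.
      2:{ intros b [<-|[]]. split; [apply Hincl; left; reflexivity|exact Hne]. }
      rewrite IH; try assumption; [ring|]. intros b Hb. apply Hincl. right; exact Hb. }
  now apply Hind.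
Qed.

Lemma ln_quotient (a b : R) : 0 < a -> 0 < b -> ln (a / b) = ln a - ln b.
Proof.
  intros Ha Hb. unfold Rdiv, Rminus. rewrite ln_mult, ln_Rinv; auto using Rinv_0_lt_compat.
Qed.

Lemma ln_lipschitz (c a b : R) : 0 < c -> c < a -> c < b -> Rabs (ln a - ln b) <= / c * Rabs (a - b).
Proof.
  intros Hc.
  assert (H : forall a b, c < a -> c < b -> ln a - ln b <= / c * Rabs (a - b)).
  { clear a b. intros a b Ha Hb.
    assert (Hab : 0 < a / b) by (apply Rdiv_lt_0_compat; lra).
    rewrite <- ln_quotient by lra.
    apply Rle_trans with (/ b * (a - b)).
    - pose proof (exp_ineq1_le (ln (a / b))) as E. rewrite exp_ln in E by exact Hab.
      replace (/ b * (a - b)) with (a / b - 1) by (field; lra). lra.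
    - apply Rle_trans with (/ b * Rabs (a - b)).
      + apply Rmult_le_compat_l; [left; apply Rinv_0_lt_compat; lra|apply Rle_abs].
      + apply Rmult_le_compat_r; [apply Rabs_pos|apply Rinv_le_contravar; lra]. }
  intros Ha Hb. apply Rabs_le. pose proof (H a b Ha Hb). pose proof (H b a Hb Ha) as H'.
  rewrite Rabs_minus_sym in H'. lra.
Qed.

(** On an interval of length at most 1 the Hoelder condition bounds the second derivative by its
    value at the midpoint plus [|C|]. *)
Lemma piecewise_C2alpha_lipschitz (F : R -> R) (B : list R) (DF : R -> R) (x y : R) :
  piecewise_C2alpha F B DF -> x < y -> y <= x + 1 -> (forall z, x < z < y -> ~ is_break B z) ->
  exists M, 0 <= M /\
    forall u v, x < u < y -> x < v < y -> Rabs (DF u - DF v) <= M * Rabs (u - v).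
Proof.
  intros [al [C [D2 [Hal [HD HC]]]]] Hxy Hy Hno.
  set (m := (x + y) / 2). set (M := Rabs (D2 m) + Rabs C). exists M.
  pose proof (Rabs_pos (D2 m)). pose proof (Rabs_pos C).
  split; [unfold M; lra|].
  assert (HM : forall z, x < z < y -> Rabs (D2 z) <= M).
  { intros z Hz. replace (D2 z) with (D2 m + (D2 z - D2 m)) by ring.
    eapply Rle_trans; [apply Rabs_triang|]. unfold M. apply Rplus_le_compat_l.
    destruct (Req_dec z m) as [->|Hne]; [rewrite Rminus_diag, Rabs_R0; lra|].
    eapply Rle_trans; [apply (HC x y Hxy Hno); unfold m; lra|].
    assert (Hr : 0 < Rabs (z - m) <= 1).
    { split; [apply Rabs_pos_lt; lra|]. apply Rabs_le. unfold m; lra. }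
    assert (Hln : ln (Rabs (z - m)) <= 0).
    { rewrite <- ln_1. destruct (proj2 Hr) as [?| ->]; [left; apply ln_increasing; lra|lra]. }
    assert (Hp : 0 < Rpower (Rabs (z - m)) al <= 1).
    { unfold Rpower. split; [apply exp_pos|]. rewrite <- exp_0.
      assert (al * ln (Rabs (z - m)) <= 0) by nra.
      destruct H1 as [?| ->]; [left; now apply exp_increasing|lra]. }
    pose proof (Rle_abs C). nra. }
  intros u v Hu Hv.
  destruct (MVT_abs DF D2 v u) as [c [E Hc]].
  - intros c Hc. apply HD, Hno.
    pose proof (Rmin_glb_lt v u x). pose proof (Rmax_lub_lt v u y). lra.
  - rewrite E. apply Rmult_le_compat_r; [apply Rabs_pos|]. apply HM.
    pose proof (Rmin_glb_lt v u x). pose proof (Rmax_lub_lt v u y). lra.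
Qed.

Lemma step_break_jumps_shift (B : list R) (DL DR : R -> R) (x : R) :
  (forall b, In b B -> 0 < DL b /\ 0 < DR b) ->
  step (break_jumps B (fun b => ln (DL b / DR b))) (x + 1)
  = step (break_jumps B (fun b => ln (DL b / DR b))) x + ln (total_jump B DL DR)
  /\ 0 < total_jump B DL DR.
Proof.
  induction B as [|b B IH]; intros HB.
  - unfold total_jump. simpl. rewrite ln_1. split; [ring|lra].
  - destruct (HB b (or_introl eq_refl)) as [H1 H2].
    destruct IH as [IH1 IH2]; [intros; apply HB; right; assumption|].
    unfold step, break_jumps, total_jump in *. simpl.
    assert (0 < DL b / DR b) by (now apply Rdiv_lt_0_compat).
    rewrite IH1, ln_mult by assumption.
    replace (x + 1 - b) with (x - b + 1) by ring. rewrite floor_shift.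
    split; [ring|now apply Rmult_lt_0_compat].
Qed.

(** Across a break the logarithm of the derivative changes by [ln DR - ln DL], while [step J] gains
    [ln (DL / DR)]; their sum [Phi] therefore has no jump. Since [ln DF] is periodic, the increment
    of [Phi] over a period is that of [step J]. *)
Lemma P_homeo_break_lift (F : R -> R) (B : list R) (DF DL DR : R -> R) :
  P_homeo F B DF DL DR -> piecewise_C2alpha F B DF ->
  0 < total_jump B DL DR /\
  exists Phi K, break_lift F Phi (break_jumps B (fun b => ln (DL b / DR b))) K
                  (ln (total_jump B DL DR)).
Proof.
  intros [HC [Hnd [HB [HDF [HDLR [[c1 [c2 [Hc12 [HDFc HDLRc]]]] _]]]]]] HP.
  pose proof HC as [Hcont [_ Hs]].
  assert (Hin : forall b, In b B -> is_break B b).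
  { intros b Hb. exists b, 0%Z. split; [exact Hb|ring]. }
  assert (HBpos : forall b, In b B -> 0 < DL b /\ 0 < DR b).
  { intros b Hb. destruct (HDLRc b (Hin b Hb)). lra. }
  set (s := fun b => ln (DL b / DR b)). set (J := break_jumps B s).
  set (L := ln (total_jump B DL DR)).
  pose proof (fun x => step_break_jumps_shift B DL DR x HBpos) as HstepL.
  fold s J L in HstepL. split; [exact (proj2 (HstepL 0))|].
  set (rd := fun x => if excluded_middle_informative (is_break B x) then DR x else DF x).
  set (ld := fun x => if excluded_middle_informative (is_break B x) then DL x else DF x).
  assert (Hoff : forall x, ~ is_break B x -> rd x = DF x /\ ld x = DF x).
  { intros x Hx. unfold rd, ld. destruct (excluded_middle_informative _); [contradiction|auto]. }
  assert (Hrd : forall x, right_deriv F x (rd x) /\ c1 < rd x).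
  { intros x. unfold rd. destruct (excluded_middle_informative _) as [b|b].
    - destruct (HDLR x b), (HDLRc x b). tauto.
    - destruct (derivable_one_sided F x _ (HDF x b)), (HDFc x b). tauto. }
  assert (Hld : forall x, left_deriv F x (ld x) /\ c1 < ld x).
  { intros x. unfold ld. destruct (excluded_middle_informative _) as [b|b].
    - destruct (HDLR x b), (HDLRc x b). tauto.
    - destruct (derivable_one_sided F x _ (HDF x b)), (HDFc x b). tauto. }
  set (Phi := fun x => ln (rd x) + step J x).
  assert (HJ : forall b t, In (b, t) J -> In b B) by (intros b t; apply in_break_jumps).
  assert (HPhiL : forall x, Phi (x + 1) = Phi x + L).
  { intros x. unfold Phi. rewrite (proj1 (HstepL x)).
    replace (rd (x + 1)) with (rd x); [ring|].
    apply (right_deriv_unique F (x + 1)); [|apply Hrd].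
    apply (right_deriv_shift F x (rd x) 1 Hs), Hrd. }
  assert (Hright : forall p, exists d M, 0 < d /\ lipschitz_on Phi M p (p + d)).
  { intros p. destruct (is_break_isolated B p) as [d [Hd [Hd1 Hno]]].
    destruct (piecewise_C2alpha_lipschitz F B DF p (p + d) HP ltac:(lra) ltac:(lra)) as [M [HM0 HM]].
    { intros z Hz. apply Hno; lra. }
    assert (Hlim := right_deriv_limit F DF p d (rd p) M Hcont
      ltac:(intros c Hcc; apply HDF, Hno; lra) (proj1 (Hrd p)) HM).
    exists (d / 2), (/ c1 * M). split; [lra|]. intros u v Hu Hv. unfold Phi.
    assert (Hst : forall w, p <= w <= p + d / 2 -> step J w = step J p).
    { intros w Hw. apply step_const; [lra|]. intros b t k Hb Hk.
      apply (Hno (b + IZR k)); [lra|lra|]. exists b, k. split; [now apply (HJ b t)|reflexivity]. }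
    assert (HrdM : Rabs (rd u - rd v) <= M * Rabs (u - v)).
    { assert (E : forall w, p < w <= p + d / 2 -> rd w = DF w).
      { intros w Hw. apply Hoff, Hno; lra. }
      destruct (Req_dec u p) as [->|Hup]; destruct (Req_dec v p) as [->|Hvp].
      - rewrite !Rminus_diag, Rabs_R0; lra.
      - rewrite (E v), Rabs_minus_sym, (Rabs_minus_sym p), (Rabs_right (v - p)) by lra.
        rewrite Rabs_minus_sym. apply Hlim; lra.
      - rewrite (E u), Rabs_minus_sym, (Rabs_right (u - p)) by lra. apply Hlim; lra.
      - rewrite (E u), (E v) by lra. apply HM; lra. }
    rewrite (Hst u), (Hst v) by assumption.
    replace (ln (rd u) + step J p - (ln (rd v) + step J p)) with (ln (rd u) - ln (rd v)) by ring.
    eapply Rle_trans; [apply (ln_lipschitz c1); [lra|apply Hrd|apply Hrd]|].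
    rewrite Rmult_assoc. apply Rmult_le_compat_l; [left; apply Rinv_0_lt_compat; lra|exact HrdM]. }
  assert (Hleft : forall p, exists d M, 0 < d /\ lipschitz_on Phi M (p - d) p).
  { intros p. destruct (is_break_isolated B p) as [d [Hd [Hd1 Hno]]].
    destruct (piecewise_C2alpha_lipschitz F B DF (p - d) p HP ltac:(lra) ltac:(lra)) as [M [HM0 HM]].
    { intros z Hz. apply Hno; lra. }
    assert (Hlim := left_deriv_limit F DF p d (ld p) M Hcont
      ltac:(intros c Hcc; apply HDF, Hno; lra) (proj1 (Hld p)) HM).
    exists (d / 2), (/ c1 * M). split; [lra|].
    set (a := p - d / 2).
    assert (Hst : forall w, a <= w < p -> step J w = step J a).
    { intros w Hw. apply step_const; [lra|]. intros b t k Hb Hk. unfold a in *.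
      apply (Hno (b + IZR k)); [lra|lra|]. exists b, k. split; [now apply (HJ b t)|reflexivity]. }
    (* Seen from the left, including at [p], [Phi] is the logarithm of the left derivative plus a
       constant; at a break this is the cancellation of the jump. *)
    assert (HPhi_eq : forall w, a <= w <= p -> Phi w = ln (ld w) + step J a).
    { intros w Hw. unfold Phi. destruct (Req_dec w p) as [->|Hwp].
      - destruct (classic (is_break B p)) as [Hbp|Hbp].
        + pose proof Hbp as [b [k [Hb E]]].
          assert (Ej : step J p = step J a + s b).
          { apply (step_jump B s b a p k); try assumption; unfold a in *; [lra|].
            intros z Hz. apply Hno; lra. }
          rewrite Ej. unfold s. rewrite ln_quotient by (apply HBpos; exact Hb).
          replace (DL b) with (ld p).
          2:{ apply (left_deriv_unique F p); [apply Hld|]. rewrite E.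
              apply left_deriv_shift; [exact Hs|]. apply HDLR, Hin, Hb. }
          replace (DR b) with (rd p).
          2:{ apply (right_deriv_unique F p); [apply Hrd|]. rewrite E.
              apply right_deriv_shift; [exact Hs|]. apply HDLR, Hin, Hb. }
          ring.
        + destruct (Hoff p Hbp) as [-> ->]. f_equal.
          apply step_const; [lra|]. intros b t k Hb' Hk.
          assert (HbB : is_break B (b + IZR k)) by
            (exists b, k; split; [now apply (HJ b t)|reflexivity]).
          destruct (Req_dec (b + IZR k) p) as [Ep|Ep]; [rewrite Ep in HbB; contradiction|].
          unfold a in *. apply (Hno (b + IZR k)); [lra|exact Ep|exact HbB].
      - rewrite Hst by lra. unfold a in *. destruct (Hoff w) as [-> ->]; [apply Hno; lra|reflexivity]. }
    intros u v Hu Hv. rewrite !HPhi_eq by assumption. unfold a in Hu, Hv.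
    assert (HldM : Rabs (ld u - ld v) <= M * Rabs (u - v)).
    { assert (E : forall w, p - d / 2 <= w < p -> ld w = DF w).
      { intros w Hw. apply Hoff, Hno; lra. }
      destruct (Req_dec u p) as [->|Hup]; destruct (Req_dec v p) as [->|Hvp].
      - rewrite !Rminus_diag, Rabs_R0; lra.
      - rewrite (E v), (Rabs_right (p - v)) by lra. apply Hlim; lra.
      - rewrite (E u), Rabs_minus_sym, (Rabs_minus_sym u), (Rabs_right (p - u)) by lra.
        apply Hlim; lra.
      - rewrite (E u), (E v) by lra. apply HM; lra. }
    replace (ln (ld u) + step J a - (ln (ld v) + step J a)) with (ln (ld u) - ln (ld v)) by ring.
    eapply Rle_trans; [apply (ln_lipschitz c1); [lra|apply Hld|apply Hld]|].
    rewrite Rmult_assoc. apply Rmult_le_compat_l; [left; apply Rinv_0_lt_compat; lra|exact HldM]. }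
  destruct (lipschitz_from_local Phi Hright Hleft 0 1 ltac:(lra)) as [K HK].
  exists Phi, K. split; [exact HC|]. split; [|split; [|split; [|split]]].
  - pose proof (HK 1 0 ltac:(lra) ltac:(lra)) as B1. pose proof (Rabs_pos (Phi 1 - Phi 0)).
    rewrite (Rabs_right (1 - 0)) in B1 by lra. lra.
  - intros x. unfold Phi. replace (ln (rd x) + step J x - step J x) with (ln (rd x)) by ring.
    rewrite exp_ln; [apply Hrd|]. destruct (Hrd x). lra.
  - now apply (lipschitz_from_period Phi L).
  - exact HPhiL.
  - intros x. apply HstepL.
Qed.

(** * Choice of lifts and orientation of the conjugacy *)

Lemma break_lift_translate (F Phi : R -> R) (J : list (R * R)) (K L c : R) :
  break_lift F Phi J K L -> break_lift (fun y => F y + c) Phi J K L.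
Proof.
  intros [[Hc [Hi Hs]] [HK [Hd [HL [HP HS]]]]].
  split; [split; [|split]|split; [exact HK|split; [|tauto]]].
  - apply continuity_plus; [exact Hc|]. apply continuity_const. intros ? ?. reflexivity.
  - intros x y Hxy. specialize (Hi x y Hxy). lra.
  - intros x. rewrite Hs. ring.
  - intros x e He. destruct (Hd x e He) as [d [Hd0 Hd1]]. exists d; split; [exact Hd0|].
    intros h Hh. replace (F (x + h) + c - (F x + c)) with (F (x + h) - F x) by ring.
    now apply Hd1.
Qed.

Lemma iter_translate (F : R -> R) (k : Z) :
  (forall x, F (x + 1) = F x + 1) ->
  forall n y, Nat.iter n (fun y => F y + IZR k) y = Nat.iter n F y + INR n * IZR k.
Proof.
  intros Hs n y. induction n as [|n IH]; [simpl; ring|].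
  rewrite S_INR. simpl.
  rewrite IH, INR_IZR_INZ, <- mult_IZR, (shift_IZR F 1 Hs), mult_IZR. ring.
Qed.

Lemma rotation_number_translate (F : R -> R) (k : Z) (rho : R) :
  (forall x, F (x + 1) = F x + 1) -> rotation_number F rho ->
  rotation_number (fun y => F y + IZR k) (rho + IZR k).
Proof.
  intros Hs H x e He. destruct (H x e He) as [N HN]. exists (S N). intros n Hn.
  specialize (HN n ltac:(lia)). unfold R_dist in *. rewrite (iter_translate F k Hs).
  assert (INR n <> 0) by (apply not_0_INR; lia).
  replace ((Nat.iter n F x + INR n * IZR k) / INR n - (rho + IZR k))
    with (Nat.iter n F x / INR n - rho) by (field; assumption). exact HN.
Qed.

(** Applied to an orbit of the first lift and its image under [H], with [sg] equal to 1 or -1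
    according to the orientation of [H]. *)
Lemma growth_rate_unique (u v : nat -> R) (a b sg C : R) :
  Un_cv (fun n => u n / INR n) a -> Un_cv (fun n => v n / INR n) b ->
  (forall n, Rabs (v n - sg * u n) <= C) -> b = sg * a.
Proof.
  intros Hu Hv HC.
  apply (UL_sequence (fun n => v n / INR n)); [exact Hv|].
  assert (Hsu : Un_cv (fun n => sg * (u n / INR n)) (sg * a)).
  { apply CV_mult; [|exact Hu]. intros e He. exists O. intros. unfold R_dist.
    rewrite Rminus_diag, Rabs_R0. exact He. }
  intros e He. destruct (Hsu (e / 2) ltac:(lra)) as [N HN].
  destruct (INR_unbounded (INR N + 2 * C / e)) as [m Hm].
  assert (HC0 : 0 <= C) by (eapply Rle_trans; [apply Rabs_pos|apply (HC O)]).
  pose proof (pos_INR N). assert (0 <= 2 * C / e) by (apply Rle_mult_inv_pos; lra).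
  exists m. intros n Hn. apply le_INR in Hn.
  specialize (HN n ltac:(apply INR_le; lra)). unfold R_dist in *.
  assert (Hn0 : 0 < INR n) by lra.
  replace (v n / INR n - sg * a) with
    ((v n - sg * u n) / INR n + (sg * (u n / INR n) - sg * a)) by (field; lra).
  eapply Rle_lt_trans; [apply Rabs_triang|].
  enough (Rabs ((v n - sg * u n) / INR n) <= e / 2) by lra.
  unfold Rdiv at 1. rewrite Rabs_mult, (Rabs_right (/ INR n)) by
    (left; now apply Rinv_0_lt_compat).
  apply (Rmult_le_reg_r (INR n)); [exact Hn0|].
  rewrite Rmult_assoc, Rinv_l, Rmult_1_r by lra.
  eapply Rle_trans; [apply HC|].
  replace C with (e / 2 * (2 * C / e)) by (field; lra). apply Rmult_le_compat_l; lra.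
Qed.

(** Two different integer values would force, by the intermediate value theorem, a half-integer
    value in between. *)
Lemma integer_valued_constant (g : R -> R) :
  continuity g -> (forall x, exists k : Z, g x = IZR k) -> exists k : Z, forall x, g x = IZR k.
Proof.
  intros Hc Hg. destruct (Hg 0) as [k Hk]. exists k.
  assert (Half : forall x (m : Z), g x <> IZR m + 1 / 2).
  { intros x m E. destruct (Hg x) as [j Hj]. rewrite Hj in E.
    assert (m < j)%Z by (apply lt_IZR; lra).
    assert (j < m + 1)%Z by (apply lt_IZR; rewrite plus_IZR; lra). lia. }
  assert (Hcc : forall c, continuity (fun y => g y - c)).
  { intros c. apply continuity_minus; [exact Hc|]. apply continuity_const. intros ? ?. reflexivity. }
  intros x. apply NNPP. intros Hne.
  assert (Hcross : exists m : Z, (g 0 - (IZR m + 1 / 2)) * (g x - (IZR m + 1 / 2)) <= 0).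
  { destruct (Hg x) as [j Hj]. assert (j <> k) by (intros ->; contradiction).
    rewrite Hk, Hj. destruct (Z_lt_le_dec j k) as [Hlt|Hle].
    - exists j. assert (IZR j + 1 <= IZR k) by (rewrite <- plus_IZR; apply IZR_le; lia). nra.
    - exists k. assert (IZR k + 1 <= IZR j) by (rewrite <- plus_IZR; apply IZR_le; lia). nra. }
  destruct Hcross as [m Hm].
  destruct (Rle_or_lt 0 x) as [Hx|Hx].
  - destruct (IVT_cor _ 0 x (Hcc (IZR m + 1 / 2)) Hx Hm) as [z [_ Hz]]. apply (Half z m). lra.
  - rewrite Rmult_comm in Hm.
    destruct (IVT_cor _ x 0 (Hcc (IZR m + 1 / 2)) (Rlt_le _ _ Hx) Hm) as [z [_ Hz]].
    apply (Half z m). lra.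
Qed.

Lemma increasing_lift_near_id (H : R -> R) :
  (forall x y, x < y -> H x < H y) -> (forall x, H (x + 1) = H x + 1) ->
  forall z, Rabs (H z - z) <= Rabs (H 0) + 1.
Proof.
  intros Hi Hs z. pose proof (floor_spec z) as Hf. unfold rfloor in Hf.
  set (m := Int_part z) in *. clearbody m.
  assert (E : forall k : Z, H (IZR k) = H 0 + IZR k).
  { intros k. rewrite <- (Rplus_0_l (IZR k)) at 1. rewrite (shift_IZR H 1 Hs). ring. }
  assert (H1 : H (IZR m) <= H z).
  { destruct (proj1 Hf) as [?| <-]; [left; now apply Hi|lra]. }
  assert (H2 : H z < H (IZR (m + 1))) by (apply Hi; rewrite plus_IZR; lra).
  rewrite E in H1. rewrite E, plus_IZR in H2. pose proof (Rle_abs (H 0)). pose proof (Rle_abs (- H 0)) as H4.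
  rewrite Rabs_Ropp in H4. apply Rabs_le. lra.
Qed.

Lemma derivative_nonneg (H : R -> R) (x l : R) :
  (forall y z, y < z -> H y < H z) -> derivable_pt_lim H x l -> 0 <= l.
Proof.
  intros Hi HD. apply Rnot_lt_le. intros Hl. destruct (HD (- l) ltac:(lra)) as [d Hd].
  pose proof (cond_pos d). specialize (Hd (d / 2) ltac:(lra)).
  rewrite (Rabs_right (d / 2)) in Hd by lra. specialize (Hd ltac:(lra)).
  apply Rabs_def2 in Hd. specialize (Hi x (x + d / 2) ltac:(lra)).
  assert (0 < (H (x + d / 2) - H x) / (d / 2)) by (apply Rdiv_lt_0_compat; lra). lra.
Qed.

Theorem theorem1p5 :
  forall (F1 F2 : R -> R) (B1 B2 : list R) (DF1 DL1 DR1 DF2 DL2 DR2 : R -> R)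
         (rho1 rho2 : R),
    P_homeo F1 B1 DF1 DL1 DR1 ->
    P_homeo F2 B2 DF2 DL2 DR2 ->
    rotation_number F1 rho1 ->
    rotation_number F2 rho2 ->
    irrational rho1 ->
    (exists k : Z, rho1 = rho2 + IZR k) ->
    piecewise_C2alpha F1 B1 DF1 ->
    piecewise_C2alpha F2 B2 DF2 ->
    total_jump B1 DL1 DR1 <> total_jump B2 DL2 DR2 ->
    forall H : R -> R,
      circle_homeo_lift H ->
      (forall x, exists k : Z, H (F1 x) = F2 (H x) + IZR k) ->
      forall x l, derivable_pt_lim H x l -> l = 0.
Proof.
  intros F1 F2 B1 B2 DF1 DL1 DR1 DF2 DL2 DR2 rho1 rho2 HP1 HP2 Hr1 Hr2 Hirr [k0 Hk0] HS1 HS2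
    Hne H [Hc Hdir] Hconj x l HD.
  destruct (P_homeo_break_lift F1 B1 DF1 DL1 DR1 HP1 HS1) as [T1 [Phi1 [K1 HF1]]].
  destruct (P_homeo_break_lift F2 B2 DF2 DL2 DR2 HP2 HS2) as [T2 [Phi2 [K2 HF2]]].
  pose proof HF1 as [[Hc1 [_ Hs1]] _]. pose proof HF2 as [[Hc2 [_ Hs2]] _].
  (* The integer by which the lifts fail to commute does not depend on the point; absorbing it into
     the lift [F2'] makes the conjugacy exact. *)
  destruct (integer_valued_constant (fun y => H (F1 y) - F2 (H y))) as [k Hk].
  { apply continuity_minus; [apply (continuity_comp F1 H Hc1 Hc)|apply (continuity_comp H F2 Hc Hc2)]. }
  { intros y. destruct (Hconj y) as [k E]. exists k. lra. }
  pose proof (rotation_number_translate F2 k rho2 Hs2 Hr2) as Hr2'.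
  pose proof (break_lift_translate F2 Phi2 _ K2 _ (IZR k) HF2) as HF2'.
  set (F2' := fun y => F2 y + IZR k) in *.
  assert (Hconj' : forall y, H (F1 y) = F2' (H y)).
  { intros y. unfold F2'. specialize (Hk y). simpl in Hk. lra. }
  pose proof (iter_conjugacy F1 F2' H Hconj') as Hit.
  assert (Hrot : forall sg C, (forall z, Rabs (H z - sg * z) <= C) -> rho2 + IZR k = sg * rho1).
  { intros sg C HC.
    apply (growth_rate_unique (fun n => Nat.iter n F1 0) (fun n => Nat.iter n F2' (H 0))
             rho1 _ sg C (Hr1 0) (Hr2' (H 0))).
    intros n. rewrite <- Hit. apply HC. }
  destruct Hdir as [[Hi Hs]|[Hi Hs]].
  - specialize (Hrot 1 (Rabs (H 0) + 1)).
    rewrite Rmult_1_l in Hrot. rewrite Hrot in Hr2'.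
    2:{ intros z. rewrite Rmult_1_l. now apply increasing_lift_near_id. }
    destruct (derivative_nonneg H x l Hi HD) as [Hl| <-]; [exfalso|reflexivity].
    apply Hne, ln_inv; try assumption.
    exact (log_total_jump_eq F1 F2' H Phi1 Phi2 _ _ K1 K2 _ _ rho1 x l HF1 HF2' Hr1 Hr2' Hirr
             Hc Hi Hs Hconj' HD Hl).
  (* A reversing conjugacy would negate the rotation number: [rho2 + k = - rho1] and
     [rho1 = rho2 + k0] give [2 rho1 = k0 - k]. *)
  - exfalso. apply (Hirr (k0 - k)%Z 2%Z ltac:(lia)). rewrite minus_IZR.
    enough (rho2 + IZR k = -1 * rho1) by lra.
    apply (Hrot (-1) (Rabs (- H 0) + 1)). intros z.
    rewrite <- Rabs_Ropp. replace (- (H z - -1 * z)) with (- H z - z) by ring.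
    apply (increasing_lift_near_id (fun y => - H y)).
    + intros y w Hyw. specialize (Hi y w Hyw). lra.
    + intros y. rewrite Hs. ring.
Qed.
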